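(* Let $\mathcal{E}$ be a toric vector bundle over a complete toric variety $X_\Sigma$ with fiber $E=\mathcal{E}_{x_0}$ and with corresponding piecewise linear valuation $\mathfrak{v}:E\to\mathrm{PL}(N,\mathbb{Z})$. Let $S\subset\mathrm{PL}(N,\mathbb{Z})$ be a subset that contains the character lattice $M$ and is closed under taking maximum. Then for any $u\in M$ we have $$\dim\big(H^0(X_\Sigma,\mathcal{E})_u\big)=\operatorname{rank}\{e\in M(\mathfrak{v},S)\mid u\in P_{\mathfrak{v}(e)}\}.$$
   Context: Setting. $\mathbf{k}$ is a field of characteristic $0$; $T\cong(\mathbf{k}^* )^n$ is a split algebraic torus with character lattice $M$ and cocharacter lattice $N$, dual pairing $\langle\cdot,\cdot\rangle$, $M_\mathbb{R}=M\otimes\mathbb{R}$, $N_\mathbb{R}=N\otimes\mathbb{R}$. $\Sigma$ is a complete (finite, rational, polyhedral, strictly convex) fan in $N_\mathbb{R}$, $X_\Sigma$ its toric variety, $U_\sigma$ the affine chart of $\sigma\in\Sigma$, $\mathbf{v}_\rho$ the primitive generator of a ray $\rho\in\Sigma(1)$, $x_0$ a fixed point of the open torus orbit. A toric vector bundle is a vector bundle on $X_\Sigma$ with a $T$-linearization (a lift of the $T$-action, linear on fibers). $T$ acts on sections by $(t\cdot s)(x)=t\cdot s(t^{-1}x)$, and a subscript $u\in M$ denotes the weight space of weight $u$. $\mathrm{PL}(N,\mathbb{Z})$ is the set of functions $N_\mathbb{R}\to\mathbb{R}$ that are linear on each cone of some complete fan and take integer values on $N$, together with an element $\infty$ (constant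 function infinity), ordered pointwise. A character $u\in M$ is viewed as the linear function $x\mapsto\langle u,x\rangle$, so $M\subset\mathrm{PL}(N,\mathbb{Z})$. The valuation of $\mathcal{E}$. For $\rho\in\Sigma(1)$, $i\in\mathbb{Z}$ let $E^\rho_i\subset E$ be the image under evaluation at $x_0$ of $\Gamma(U_\rho,\mathcal{E})_u$ for any $u\in M$ with $\langle u,\mathbf{v}_\rho\rangle=i$ (the Klyachko filtrations). For every $\sigma\in\Sigma$ there are a decomposition $E=\bigoplus_{j=1}^rL_{\sigma,j}$ into lines and characters $u_{\sigma,1},\dots,u_{\sigma,r}\in M$ (well defined modulo $\sigma^\perp$) with $E^\rho_i=\bigoplus_{\langle u_{\sigma,j},\mathbf{v}_\rho\rangle\ge i}L_{\sigma,j}$ for all rays $\rho$ of $\sigma$ and all $i$. Then $\mathfrak{v}(0)=\infty$ and for $0\ne e\in E$ and $x\in\sigma$, $\mathfrak{v}(e)(x)=\min\{\langle x,u_{\sigma,j}\rangle\mid e_j\neq0\}$, where $e=\sum_je_j$, $e_j\in L_{\sigma,j}$. The map $\mathfrak{v}$ satisfies $\mathfrak{v}(ce)=\mathfrak{v}(e)$ for $c\in\mathbf{k}\setminus\{0\}$, $\mathfrak{v}(e_1+e_2)\ge\min(\mathfrak{v}(e_1),\mathfrak{v}(e_2))$, $\mathfrak{v}(e)=\infty$ iff $e=0$, and has finite image. The matroid $M(\mathfrak{v},S)$. For $\phi\in S$ let $E_{\ge\phi}=\{e\in E\mid\mathfrak{v}(e)\ge\phi\}$, a linear subspace, and let $\mathcal{A}_{\mathfrak{v},S}=\{E_{\ge\phi}\mid\phi\in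 S\}$; it is a finite subspace arrangement closed under intersection. For a finite arrangement $\mathcal{A}$ of subspaces of $E$ closed under intersection, let $U_1,\dots,U_m$ be the subspaces in $\mathcal{A}$ that are not sums of other subspaces in $\mathcal{A}$, pick a basis $B_i$ of each $U_i$ and put $\mathcal{B}=\bigcup_iB_i$; $\mathcal{B}$ is called generic if for all $B_0\subset\mathcal{B}$ and $e_i\in B_i\setminus B_0$, $e_i\in\operatorname{span}(B_0)$ if and only if $U_i\subset\operatorname{span}(B_0)$. The matroid of $\mathcal{A}$ is the matroid (of linear independence) of the set of vectors $\mathcal{B}$ for a generic $\mathcal{B}$. $M(\mathfrak{v},S)$ is the matroid of $\mathcal{A}_{\mathfrak{v},S}$, and $M(\mathfrak{v},S)$ also denotes its ground set $\mathcal{B}\subset E$; rank is the matroid rank, i.e. the dimension of the linear span. Polytopes. For $\phi\in\mathrm{PL}(N,\mathbb{Z})$, $P_\phi=\{y\in M_\mathbb{R}\mid\langle x,y\rangle\le\phi(x)\ \forall x\in N_\mathbb{R}\}$ (possibly empty). *)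

(* Defs.v *)
From HB Require Import structures.
From mathcomp Require Import all_boot all_order all_algebra.
From mathcomp Require Import boolp classical_sets functions cardinality.
From mathcomp Require Import reals constructive_ereal.

Set Implicit Arguments.
Unset Strict Implicit.
Unset Printing Implicit Defensive.

Import Order.TTheory GRing.Theory Num.Theory.
Local Open Scope classical_set_scope.
Local Open Scope ring_scope.

(* A basis of the torus is fixed, so that M = N = Z^n with the standard
   pairing, and M_R = N_R = R^n; vectors are row vectors. *)
Section Lattice.
Variables (R : realType) (n : nat).

Definition latR (w : 'rV[int]_n) : 'rV[R]_n := map_mx intr w.

Definition pairZ (u w : 'rV[int]_n) : int := \sum_i u 0 i * w 0 i.

Definition pairR (y x : 'rV[R]_n) : R := \sum_i y 0 i * x 0 i.

Definition charR (u : 'rV[int]_n) (x : 'rV[R]_n) : R := pairR (latR u) x.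

Definition rational_polyhedral_cone (sigma : set 'rV[R]_n) :=
  exists (p : nat) (w : 'I_p -> 'rV[int]_n),
    sigma = [set x | exists a : 'I_p -> R,
      (forall i, 0 <= a i) /\ x = \sum_i a i *: latR (w i)].

Definition strictly_convex (sigma : set 'rV[R]_n) :=
  forall x, sigma x -> sigma (- x) -> x = 0.

Definition dual_cone (sigma : set 'rV[R]_n) : set 'rV[R]_n :=
  [set y | forall x, sigma x -> 0 <= pairR y x].

Definition face (tau sigma : set 'rV[R]_n) :=
  exists2 m, dual_cone sigma m & tau = sigma `&` [set x | pairR m x = 0].

(* Given the axioms on faces and strict convexity, [fan_zero] only says that
   the fan is nonempty. *)
Record fan := Fan {
  cones : set (set 'rV[R]_n);
  fan_finite : finite_set cones;
  fan_rational : forall sigma, cones sigma -> rational_polyhedral_cone sigma;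
  fan_strict : forall sigma, cones sigma -> strictly_convex sigma;
  fan_face : forall sigma tau, cones sigma -> face tau sigma -> cones tau;
  fan_inter : forall sigma tau, cones sigma -> cones tau ->
    face (sigma `&` tau) sigma /\ face (sigma `&` tau) tau;
  fan_zero : cones [set 0]
}.

Definition complete (F : fan) :=
  forall x, exists2 sigma, cones F sigma & sigma x.

Definition cone_of (F : fan) := {sigma : set 'rV[R]_n | sigma \in cones F}.

Definition zero_cone (F : fan) : cone_of F :=
  exist _ [set 0] (mem_set (@fan_zero F)).

Definition primitive (w : 'rV[int]_n) :=
  forall (w' : 'rV[int]_n) (d : nat), w = w' *+ d -> d = 1%N.

Definition primitive_generator (rho : set 'rV[R]_n) (w : 'rV[int]_n) :=
  primitive w /\ rho = [set x | exists2 a : R, 0 <= a & x = a *: latR w].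

Definition PLfun (f : 'rV[R]_n -> R) :=
  (exists2 F : fan, complete F & forall sigma, cones F sigma ->
     exists l : 'rV[R]_n, forall x, sigma x -> f x = pairR l x) /\
  (forall w : 'rV[int]_n, f (latR w) \is a Num.int).

(* PL(N, Z), the extra element oo being the constant function +oo. *)
Definition PL : set ('rV[R]_n -> \bar R) :=
  [set phi | phi = cst +oo%E \/ exists2 f, PLfun f & phi = EFin \o f].

Definition polytope (phi : 'rV[R]_n -> \bar R) : set 'rV[R]_n :=
  [set y | forall x, ((pairR y x)%:E <= phi x)%E].

End Lattice.

(* The group T(k) = (k^* )^n of rational points of the torus. *)
Section Torus.
Variables (k : fieldType) (n : nat).

Definition torus_pred : {pred 'rV[k]_n} := fun t => [forall i, t 0 i != 0].

Record torus := Torus { tcoord :> 'rV[k]_n; tcoordP : tcoord \in torus_pred }.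
HB.instance Definition _ := [isSub for tcoord].
HB.instance Definition _ := [Choice of torus by <:].

Lemma tcoord_neq0 (t : torus) i : t 0%R i != 0.
Proof. by have /forallP := tcoordP t. Qed.

Fact torus_mul_subproof (s t : torus) :
  (\row_i (s 0%R i * t 0%R i)) \in torus_pred.
Proof. by apply/forallP => i; rewrite mxE mulf_neq0 ?tcoord_neq0. Qed.
Definition torus_mul s t := Torus (torus_mul_subproof s t).

Fact torus_one_subproof : (const_mx 1 : 'rV[k]_n) \in torus_pred.
Proof. by apply/forallP => i; rewrite mxE oner_neq0. Qed.
Definition torus_one := Torus torus_one_subproof.

Fact torus_inv_subproof (t : torus) : (\row_i (t 0%R i)^-1) \in torus_pred.
Proof. by apply/forallP => i; rewrite mxE invr_eq0 tcoord_neq0. Qed.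
Definition torus_inv t := Torus (torus_inv_subproof t).

Fact torus_mulA : associative torus_mul.
Proof. by move=> r s t; apply/val_inj/rowP => i; rewrite !mxE mulrA. Qed.
Fact torus_mul1 : left_id torus_one torus_mul.
Proof. by move=> t; apply/val_inj/rowP => i; rewrite !mxE mul1r. Qed.
Fact torus_mulr1 : right_id torus_one torus_mul.
Proof. by move=> t; apply/val_inj/rowP => i; rewrite !mxE mulr1. Qed.
Fact torus_mulV : left_inverse torus_one torus_inv torus_mul.
Proof.
by move=> t; apply/val_inj/rowP => i; rewrite !mxE mulVf ?tcoord_neq0.
Qed.
Fact torus_mulrV : right_inverse torus_one torus_inv torus_mul.
Proof.
by move=> t; apply/val_inj/rowP => i; rewrite !mxE mulfV ?tcoord_neq0.
Qed.
HB.instance Definition _ := isGroup.Build torus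
  torus_mulA torus_mul1 torus_mulr1 torus_mulV torus_mulrV.
HB.instance Definition _ := isPointed.Build torus torus_one.

Definition chi (u : 'rV[int]_n) (t : torus) : k := \prod_i t 0%R i ^ u 0%R i.

Lemma chi0 t : chi 0 t = 1.
Proof. by rewrite /chi big1 // => i _; rewrite mxE expr0z. Qed.

Lemma chiD u v t : chi (u + v) t = chi u t * chi v t.
Proof.
rewrite /chi -big_split; apply: eq_bigr => i _.
by rewrite mxE expfzDr ?tcoord_neq0.
Qed.

End Torus.

(* The coordinate ring k[sigma^vee cap M] of the affine chart U_sigma.  Its
   elements are represented by their restrictions to T(k); since k is infinite
   (characteristic 0), distinct elements of k[M] have distinct restrictions. *)
Section CoordRing.
Variables (R : realType) (k : fieldType) (n : nat) (sigma : set 'rV[R]_n).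

Definition monomials : set 'rV[int]_n := [set m | dual_cone sigma (latR R m)].

Definition regular_pred : {pred torus k n -> k} := fun f =>
  `[< exists (p : nat) (c : 'I_p -> k) (m : 'I_p -> 'rV[int]_n),
      (forall i, monomials (m i)) /\
      f = (fun t => \sum_i c i * chi (m i) t) >].

Lemma monomials0 : monomials 0.
Proof.
by move=> x _; rewrite /pairR big1 // => i _; rewrite !mxE mul0r.
Qed.

Lemma monomialsD u v : monomials u -> monomials v -> monomials (u + v).
Proof.
move=> uS vS x sx; have := addr_ge0 (uS x sx) (vS x sx).
rewrite /pairR -big_split /=; congr (0 <= _); apply: eq_bigr => i _.
by rewrite !mxE rmorphD mulrDl.
Qed.

Lemma regular_cst (c : k) : cst c \in regular_pred.
Proof.
apply/asboolP; exists 1%N, (fun=> c), (fun=> 0); split=> [_|].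
  exact: monomials0.
by apply/funext => t; rewrite big_ord1 chi0 mulr1.
Qed.

Fact regular_subring_closed : subring_closed regular_pred.
Proof.
split; first exact: (regular_cst 1).
- move=> _ _ /asboolP[p [c [m [mS ->]]]] /asboolP[q [d [l [lS ->]]]].
  apply/asboolP; exists (p + q)%N.
  exists (fun i =>
    match fintype.split i with inl j => c j | inr j => - d j end).
  exists (fun i =>
    match fintype.split i with inl j => m j | inr j => l j end).
  split; first by move=> i; case: (fintype.split i).
  apply/funext => t; rewrite big_split_ord; congr (_ + _).
    by apply: eq_bigr => i _; rewrite (unsplitK (inl _ i)).
  rewrite -[LHS]sumrN; apply: eq_bigr => i _.
  by rewrite (unsplitK (inr _ i)) mulNr.
- move=> _ _ /asboolP[p [c [m [mS ->]]]] /asboolP[q [d [l [lS ->]]]].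
  pose T := ('I_p * 'I_q)%type; apply/asboolP; exists #|{: T}|.
  exists (fun i => let ij : T := enum_val i in c ij.1 * d ij.2).
  exists (fun i => let ij : T := enum_val i in m ij.1 + l ij.2).
  split=> [i|]; first exact: monomialsD.
  apply/funext => t.
  transitivity ((\sum_i c i * chi (m i) t) * (\sum_j d j * chi (l j) t)) => //.
  rewrite mulr_suml; under eq_bigr => i _ do rewrite mulr_sumr.
  rewrite pair_big /= (reindex_onto (@enum_val {: T} _) enum_rank) /=.
    apply: eq_big => [i|i _]; first by rewrite enum_valK eqxx.
    by rewrite chiD mulrACA.
  by move=> ij _; rewrite enum_rankK.
Qed.
HB.instance Definition _ :=
  GRing.isSubringClosed.Build (torus k n -> k) regular_pred
    regular_subring_closed.

Record coordRing := CoordRing {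
  regfun :> torus k n -> k; regfunP : regfun \in regular_pred }.
HB.instance Definition _ := [isSub for regfun].
HB.instance Definition _ := [Choice of coordRing by <:].
HB.instance Definition _ :=
  [SubChoice_isSubComNzRing of coordRing by <:].

Definition cstA (c : k) : coordRing := CoordRing (regular_cst c).

End CoordRing.

Section ToricVectorBundle.
Variables (R : realType) (k : fieldType) (n : nat) (F : fan R n).
Local Notation A sigma := (coordRing k (val (sigma : cone_of F))).

(* The module G over the coordinate ring is locally free of finite rank on
   Spec: there are finitely many f generating the unit ideal such that the
   localization G_f is free with (denominators being cleared) basis b. *)
Definition locally_free (A : comNzRingType) (G : lmodType A) :=
  exists (q : nat) (f g : 'I_q -> A), \sum_i g i * f i = 1 /\
    forall i, exists (r : nat) (b : 'I_r -> G),
      (forall s, exists (N : nat) (c : 'I_r -> A),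
         f i ^+ N *: s = \sum_j c j *: b j) /\
      (forall c : 'I_r -> A, \sum_j c j *: b j = 0 ->
         exists N : nat, forall j, f i ^+ N * c j = 0).

(* A locally free sheaf on X_Sigma given by its sections on the affine charts.
   The map [res sigma tau] is only meaningful when tau is a face of sigma, in
   which case U_tau is open in U_sigma and the coordinate ring of U_tau is the
   localization of that of U_sigma at the monomials vanishing on tau; the
   axioms [res_ker] and [res_frac] say that the sections on U_tau are the
   corresponding localization of the sections on U_sigma (quasi-coherence).
   The relation [g = f :> (torus k n -> k)] says that g is the restriction
   of f. *)
Record vectorBundle := VectorBundle {
  sec : forall sigma : cone_of F, lmodType (A sigma);
  res : forall sigma tau : cone_of F, sec sigma -> sec tau;
  resD : forall sigma tau : cone_of F, face (val tau) (val sigma) ->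
    forall s s' : sec sigma, res tau (s + s') = res tau s + res tau s';
  resZ : forall sigma tau : cone_of F, face (val tau) (val sigma) ->
    forall (f : A sigma) (g : A tau) (s : sec sigma),
      g = f :> (torus k n -> k) -> res tau (f *: s) = g *: res tau s;
  res_id : forall sigma (s : sec sigma), res sigma s = s;
  res_comp : forall sigma tau ups : cone_of F, face (val tau) (val sigma) ->
    face (val ups) (val tau) ->
    forall s : sec sigma, res ups (res tau s) = res ups s;
  res_ker : forall sigma tau : cone_of F, face (val tau) (val sigma) ->
    forall s : sec sigma, res tau s = 0 ->
      exists (m : 'rV[int]_n) (f : A sigma),
        [/\ forall x, val tau x -> charR m x = 0,
            f = chi m :> (torus k n -> k) & f *: s = 0];
  res_frac : forall sigma tau : cone_of F, face (val tau) (val sigma) ->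
    forall s' : sec tau,
      exists (m : 'rV[int]_n) (f : A tau) (s : sec sigma),
        [/\ monomials (val sigma) m, forall x, val tau x -> charR m x = 0,
            f = chi m :> (torus k n -> k) & f *: s' = res tau s];
  sec_locally_free : forall sigma, locally_free (sec sigma)
}.

(* A T-linearization, given by the action (t . s)(x) = t . s(t^-1 x) on the
   sections over the charts.  [act_algebraic] says that t . s is a regular
   function of t with values in the sections, i.e. that the action comes from
   a morphism of schemes. *)
Record toricBundle := ToricBundle {
  bundle :> vectorBundle;
  act : forall sigma, torus k n -> sec bundle sigma -> sec bundle sigma;
  act1 : forall sigma (s : sec bundle sigma), act 1%g s = s;
  actM : forall sigma (t t' : torus k n) (s : sec bundle sigma),
    act (t * t')%g s = act t (act t' s);
  actD : forall sigma t (s s' : sec bundle sigma),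
    act t (s + s') = act t s + act t s';
  actZ : forall sigma (t : torus k n) (f g : A sigma) (s : sec bundle sigma),
    (forall x, g x = f (t^-1 * x)%g) -> act t (f *: s) = g *: act t s;
  act_res : forall sigma tau : cone_of F, face (val tau) (val sigma) ->
    forall t (s : sec bundle sigma),
      res tau (act t s) = act t (res tau s);
  act_algebraic : forall sigma (s : sec bundle sigma),
    exists (p : nat) (u : 'I_p -> 'rV[int]_n) (s' : 'I_p -> sec bundle sigma),
      forall t, act t s = \sum_i cstA (val sigma) (chi (u i) t) *: s' i
}.

Section Sections.
Variable V : toricBundle.

Definition weight_sec (sigma : cone_of F) (u : 'rV[int]_n) :
    set (sec V sigma) :=
  [set s | forall t, act t s = cstA (val sigma) (chi u t) *: s].

Definition global_section (s : forall sigma, sec V sigma) :=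
  forall sigma tau : cone_of F, face (val tau) (val sigma) ->
    res tau (s sigma) = s tau.

(* H^0(X_Sigma, V)_u *)
Definition H0_weight (u : 'rV[int]_n) : set (forall sigma, sec V sigma) :=
  [set s | global_section s /\ forall sigma, weight_sec u (s sigma)].

(* d is the dimension over k of the space H of families of sections *)
Definition has_dim (H : set (forall sigma, sec V sigma)) (d : nat) :=
  exists b : 'I_d -> forall sigma, sec V sigma,
    (forall i, H (b i)) /\
    forall s, H s -> exists! c : {ffun 'I_d -> k},
      forall sigma, s sigma = \sum_i cstA (val sigma) (c i) *: b i sigma.

(* E, together with the evaluation map ev, is the fiber of V at the point x0
   of the open orbit U_{0} = T: it is the quotient of the sections on T by the
   maximal ideal of x0. *)
Definition is_fiber (x0 : torus k n) (E : vectType k)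
    (ev : sec V (zero_cone F) -> E) :=
  [/\ forall s s', ev (s + s') = ev s + ev s',
      forall (f : A (zero_cone F)) s, ev (f *: s) = f x0 *: ev s,
      forall e, exists s, ev s = e &
      forall s, ev s = 0 ->
        exists (p : nat) (f : 'I_p -> A (zero_cone F))
               (s' : 'I_p -> sec V (zero_cone F)),
          (forall i, f i x0 = 0) /\ s = \sum_i f i *: s' i].

Section Valuation.
Variables (E : vectType k) (ev : sec V (zero_cone F) -> E).

(* The step i of the Klyachko filtration of the ray rho with primitive
   generator w. *)
Definition klyachko (rho : cone_of F) (w : 'rV[int]_n) (i : int) : set E :=
  [set e | exists (u : 'rV[int]_n) (s : sec V rho),
     [/\ pairZ u w = i, weight_sec u s & ev (res (zero_cone F) s) = e]].

(* L and u are the decomposition of E into lines and the characters attached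
   to the cone sigma. *)
Definition klyachko_decomposition (sigma : cone_of F)
    (L : 'I_(\dim {:E}) -> {vspace E})
    (u : 'I_(\dim {:E}) -> 'rV[int]_n) :=
  [/\ forall j, \dim (L j) = 1%N,
      directv (\sum_j L j), (\sum_j L j)%VS = fullv &
      forall (rho : cone_of F) w, face (val rho) (val sigma) ->
        primitive_generator (val rho) w ->
        forall i e, klyachko rho w i e <->
          e \in (\sum_(j | (i <= pairZ (u j) w)%R) L j)%VS].

Definition is_valuation (v : E -> 'rV[R]_n -> \bar R) :=
  [/\ forall e, PL (v e),
      v 0 = cst +oo%E &
      forall sigma, exists (L : 'I_(\dim {:E}) -> {vspace E})
                           (u : 'I_(\dim {:E}) -> 'rV[int]_n),
        klyachko_decomposition sigma L u /\
        forall c : 'I_(\dim {:E}) -> E, (forall j, c j \in L j) ->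
          \sum_j c j != 0 -> forall x, val sigma x ->
          v (\sum_j c j) x =
            \big[Order.min/+oo%E]_(j | c j != 0) (charR (u j) x)%:E].

End Valuation.
End Sections.
End ToricVectorBundle.

Arguments H0_weight {R k n F} V u.

Section Matroid.
Variables (k : fieldType) (E : vectType k).

Definition irreducible_in (Arr : set {vspace E}) (U : {vspace E}) :=
  Arr U /\ ~ exists s : seq {vspace E},
    (forall W, W \in s -> Arr W /\ W <> U) /\ U = (\sum_(W <- s) W)%VS.

Definition generic (m : nat) (U : 'I_m -> {vspace E}) (B : 'I_m -> seq E) :=
  forall B0 : seq E, (forall e, e \in B0 -> exists i, e \in B i) ->
    forall i e, e \in B i -> e \notin B0 ->
      (e \in <<B0>>%VS <-> (U i <= <<B0>>)%VS).

(* BB enumerates the ground set of the matroid of the arrangement, obtained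
   from a generic choice of bases of the irreducible subspaces. *)
Definition matroid_ground_set (Arr : set {vspace E}) (BB : seq E) :=
  exists (m : nat) (U : 'I_m -> {vspace E}) (B : 'I_m -> seq E),
    [/\ injective U,
        forall W, irreducible_in Arr W <-> exists i, W = U i,
        forall i, basis_of (U i) (B i),
        generic U B &
        uniq BB /\ forall e, e \in BB <-> exists i, e \in B i].

(* The rank, in the matroid of linear independence of BB, of the set of those
   elements of BB that satisfy P. *)
Definition matroid_rank (BB : seq E) (P : set E) : nat :=
  \dim <<[seq e <- BB | `[< P e >]]>>.

(* The arrangement of the subspaces E_{>= phi}, phi in S *)
Definition arrangement (R : realType) (n : nat) (v : E -> 'rV[R]_n -> \bar R)
    (S : set ('rV[R]_n -> \bar R)) : set {vspace E} :=
  [set U : {vspace E} | exists2 phi, S phi &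
     forall e : E, e \in U <-> forall x, (phi x <= v e x)%E].

End Matroid.

(* Main.v *)
Require Import Defs.
From HB Require Import structures.
From mathcomp Require Import all_boot all_order all_algebra.
From mathcomp Require Import boolp classical_sets functions.
From mathcomp Require Import reals constructive_ereal.
From mathcomp Require Import ring lra.

(** The theorem compares two descriptions of the subspace [E_u] of the vectors
    [e] of the fiber with [u <= v e].

    On the side of the matroid, [E_u] is a member of the arrangement, since the
    character [u] belongs to [S].  Every member of the arrangement is a sum of
    irreducible members, and the ground set contains a basis of each of these;
    so [E_u] is spanned by the elements of the ground set that it contains
    ([ground_set_spans]), and these are the ones whose polytope contains [u].

    On the side of the bundle, evaluation at [x0] identifies the global sections
    of weight [u] with [E_u].
    - Over the open orbit, evaluation at [x0] is a bijection from the sections of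
      weight [u] onto [E] ([ev_weight_inj], [ev_weight_surj]).  Multiplication by
      characters identifies all the weight spaces, so a section over the orbit is
      a Laurent polynomial with coefficients in the space of weight [u]; it can
      be evaluated at [x0], and it is constant if its weight is [u].  This uses
      that characters are linearly independent ([chi_independent]).
    - A section over the orbit extends to the chart of a cone as soon as it
      extends to the charts of its rays ([extend_from_rays]).  Locally on the
      chart the bundle is free and the coordinates of the section are Laurent
      polynomials, up to denominators; a Laurent polynomial is regular on a cone
      when it is regular on the rays, because exponents can be tested on
      generators ([regular_on_generators]).
    - Hence [e] comes from a global section of weight [u] exactly when, for every
      ray with primitive generator [w], it lies in the step [<u, w>] of the
      filtration of the ray ([global_section_rays]).
    - The inequality [u <= v e] is equivalent to the same conditions
      ([valuation_rays]): on a cone [v e] is the minimum of the characters of the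
      components of [e], and such a minimum is bounded below by [u] on the cone
      as soon as it is on the generators.

    Both of the last steps need that a strictly convex rational cone is generated
    by those of its faces that are rays ([cone_rays]).  For a minimal family of
    generators, Gordan's alternative ([gordan]) provides the functional that cuts
    out the ray of a given generator. *)

Set Implicit Arguments.
Unset Strict Implicit.
Unset Printing Implicit Defensive.

Import Order.TTheory GRing.Theory Num.Theory.
Local Open Scope classical_set_scope.
Local Open Scope ring_scope.

(** * Characters of the torus *)

Section Characters.
Variables (k : fieldType) (n : nat).
Implicit Types (s t : torus k n) (u w : 'rV[int]_n).

Lemma torus_mulC s t : (s * t = t * s)%g.
Proof. by apply/val_inj/rowP => i; rewrite !mxE mulrC. Qed.

Lemma chiM u s t : chi u (s * t)%g = chi u s * chi u t.
Proof.
by rewrite /chi -big_split; apply: eq_bigr => i _; rewrite mxE expfzMl.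
Qed.

Lemma chi1 u : chi u (1%g : torus k n) = 1.
Proof. by rewrite /chi big1 // => i _; rewrite mxE exp1rz. Qed.

Lemma chi_neq0 u t : chi u t != 0.
Proof.
by apply/prodf_neq0 => i _; rewrite expfz_neq0 // tcoord_neq0.
Qed.

Lemma chiNK u t : chi u t * chi (- u) t = 1.
Proof. by rewrite -chiD subrr chi0. Qed.

Lemma chiV u t : chi u t^-1%g = chi (- u) t.
Proof.
apply: (mulfI (chi_neq0 u t)).
by rewrite chiNK -chiM (mulgV t) chi1.
Qed.

Hypothesis k_char0 : [pchar k] =i pred0.

Lemma expz2_inj (a b : int) : (2%:R : k) ^ a = 2%:R ^ b -> a = b.
Proof.
have n0 := (pcharf0P k).1 k_char0.
have k2 : (2%:R : k) != 0 by rewrite n0.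
have pos m : (2%:R : k) ^ (Posz m) = 1 -> m = 0%N.
  case: m => // m /eqP; rewrite -exprnP -natrX -subr_eq0 -[X in _ - X]/(1%:R).
  rewrite -natrB ?expn_gt0 //.
  by rewrite n0 subn_eq0 leqNgt (ltn_exp2l 0).
move=> eab; apply/eqP; rewrite -subr_eq0; apply/eqP.
have: (2%:R : k) ^ (a - b) = 1 by rewrite expfzDr // eab -expfzDr // subrr.
case: (a - b) => [m /pos -> //|m].
rewrite NegzE => e; have /pos // : (2%:R : k) ^ Posz m.+1 = 1.
by rewrite -(opprK (Posz _)) -invr_expz e invr1.
Qed.

(** Points with one coordinate equal to 2 and the others equal to 1 separate the
    characters, because 2 is not a root of unity in characteristic 0. *)
Lemma chi_separates u w : u != w -> exists t, chi u t != chi w t.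
Proof.
move=> uw; have [i /eqP ui] : exists i, u 0 i <> w 0 i.
  by apply/not_existsP => e; case/eqP: uw; apply/rowP => i; apply: contrapT (e i).
have tP : (\row_j (if j == i then 2%:R else 1 : k)) \in torus_pred (n:=n).
  apply/forallP => j; rewrite mxE; case: ifP => _; last exact: oner_neq0.
  by rewrite ((pcharf0P k).1 k_char0).
have chiE x : chi x (Torus tP) = 2%:R ^ x 0 i.
  rewrite /chi (bigD1 i) //= mxE eqxx big1 ?mulr1 // => j /negPf ji.
  by rewrite mxE ji exp1rz.
by exists (Torus tP); rewrite !chiE; apply: contra ui => /eqP/expz2_inj/eqP.
Qed.

(** A combination of point evaluations that is 1 on [w] and kills every other
    character of [K]: for each [x] of [K] the product contains a factor
    that vanishes on [x]. *)
Lemma chi_interpolation (K : seq 'rV[int]_n) w :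
  exists q : seq (k * torus k n), forall x, x \in w :: K ->
    \sum_(c <- q) c.1 * chi x c.2 = (x == w)%:R.
Proof.
elim: K => [|x K [q IH]].
  exists [:: (1, 1%g)] => x; rewrite inE => /eqP ->.
  by rewrite big_seq1 mul1r chi1 eqxx.
have [->|] := eqVneq x w.
  by exists q => y; rewrite inE => /predU1P[->|/IH//]; apply/IH/mem_head.
move=> xw; have [t tP] := chi_separates xw.
pose d := (chi w t - chi x t)^-1.
have dE : (chi w t - chi x t) * d = 1 by rewrite mulfV // subr_eq0 eq_sym.
exists ([seq (d * c.1, (t * c.2)%g) | c <- q]
        ++ [seq (- (d * chi x t * c.1), c.2) | c <- q]) => y.
have -> : \sum_(c <- [seq (d * c.1, (t * c.2)%g) | c <- q]
        ++ [seq (- (d * chi x t * c.1), c.2) | c <- q]) c.1 * chi y c.2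
    = (chi y t - chi x t) * d * \sum_(c <- q) c.1 * chi y c.2.
  rewrite big_cat !big_map /= -big_split mulr_sumr; apply: eq_bigr => c _ /=.
  by rewrite chiM; ring.
rewrite !inE => /or3P[/eqP-> | /eqP-> | yK].
- by rewrite IH ?mem_head // dE mul1r.
- by rewrite subrr mul0r mul0r (negPf xw).
- rewrite IH ?inE ?yK ?orbT //; have [->|] := eqVneq y w; first by rewrite dE mul1r.
  by rewrite mulr0.
Qed.

(** Dedekind's independence of characters, with coefficients in a module: the
    interpolation at [w] extracts the coefficient of [chi w] from the sum. *)
Lemma chi_independent (A : comNzRingType) (cst : {rmorphism k -> A})
    (G : lmodType A) (l : seq ('rV[int]_n * G)) :
  (forall t, \sum_(p <- l) cst (chi p.1 t) *: p.2 = 0) ->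
  forall w, \sum_(p <- l | p.1 == w) p.2 = 0.
Proof.
move=> l0 w; have [q qP] := chi_interpolation (map fst l) w.
have : \sum_(c <- q) cst c.1 *: (\sum_(p <- l) cst (chi p.1 c.2) *: p.2) = 0.
  by rewrite big1 // => c _; rewrite l0 scaler0.
under eq_bigr => c _ do rewrite scaler_sumr.
rewrite exchange_big /= => e; rewrite -[RHS]e big_mkcond /=.
apply: eq_big_seq => p pl.
under [RHS]eq_bigr => c _ do rewrite scalerA -rmorphM.
rewrite -scaler_suml -rmorph_sum /= qP ?inE ?(map_f fst) ?orbT //.
by case: eqP; rewrite ?rmorph0 ?rmorph1 ?scale1r ?scale0r.
Qed.

End Characters.

(** * Rational polyhedral cones are generated by their rays *)

Section Pairing.
Variables (R : realType) (n : nat).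
Implicit Types (x y : 'rV[R]_n) (u w : 'rV[int]_n).

Lemma pairRE y x : pairR y x = (y *m x^T) 0 0.
Proof. by rewrite mxE; apply: eq_bigr => i _; rewrite mxE. Qed.

Lemma pairRC y x : pairR y x = pairR x y.
Proof. by apply: eq_bigr => i _; rewrite mulrC. Qed.

Lemma pairRDr y x x' : pairR y (x + x') = pairR y x + pairR y x'.
Proof. by rewrite !pairRE linearD mulmxDr mxE. Qed.

Lemma pairRZr y a x : pairR y (a *: x) = a * pairR y x.
Proof. by rewrite !pairRE linearZ -scalemxAr mxE. Qed.

Lemma pairR0r y : pairR y (0 : 'rV[R]_n) = 0.
Proof. by rewrite pairRE trmx0 mulmx0 mxE. Qed.

Lemma pairRDl y y' x : pairR (y + y') x = pairR y x + pairR y' x.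
Proof. by rewrite pairRC pairRDr !(pairRC x). Qed.

Lemma pairRZl a y x : pairR (a *: y) x = a * pairR y x.
Proof. by rewrite pairRC pairRZr (pairRC x). Qed.

Lemma pairRBr y x x' : pairR y (x - x') = pairR y x - pairR y x'.
Proof. by rewrite pairRDr -scaleN1r pairRZr mulN1r. Qed.

Lemma pairRBl y y' x : pairR (y - y') x = pairR y x - pairR y' x.
Proof. by rewrite pairRC pairRBr !(pairRC x). Qed.

Lemma pairR_sumr (I : Type) (r : seq I) (P : pred I) (f : I -> 'rV[R]_n) y :
  pairR y (\sum_(i <- r | P i) f i) = \sum_(i <- r | P i) pairR y (f i).
Proof. exact: (big_morph _ (pairRDr y) (pairR0r y)). Qed.

Lemma pairR_gt0 x : x != 0 -> 0 < pairR x x.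
Proof.
move=> x0; rewrite lt_neqAle eq_sym sumr_ge0 ?andbT => [|i _]; last first.
  by rewrite -expr2 sqr_ge0.
apply: contra x0 => /eqP e; apply/eqP/rowP => i; rewrite mxE; apply/eqP.
rewrite -[_ == 0]orbb -mulf_eq0; apply/eqP.
by apply: (psumr_eq0P _ e) => // j _; rewrite -expr2 sqr_ge0.
Qed.

Lemma charR_latR u w : charR u (latR R w) = (pairZ u w)%:~R.
Proof.
rewrite /charR /pairR /pairZ rmorph_sum; apply: eq_bigr => i _.
by rewrite !mxE rmorphM.
Qed.

Lemma charRD u w x : charR (u + w) x = charR u x + charR w x.
Proof. by rewrite /charR /latR map_mxD pairRDl. Qed.

Lemma charRN u x : charR (- u) x = - charR u x.
Proof. by rewrite /charR /latR map_mxN -scaleN1r pairRZl mulN1r. Qed.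

Lemma charR_sum u (p : nat) (a : 'I_p -> R) (x : 'I_p -> 'rV[R]_n) :
  charR u (\sum_i a i *: x i) = \sum_i a i * charR u (x i).
Proof. by rewrite /charR pairR_sumr; apply: eq_bigr => i _; rewrite pairRZr. Qed.

End Pairing.

Section Gordan.
Variables (R : realType) (n : nat).

Lemma exists_between p (L : 'I_p -> R) (U : R) :
  (forall j, L j < U) -> exists2 c, (forall j, L j < c) & c < U.
Proof.
move=> LU; pose M := \big[Order.max/U - 1]_j L j.
have MU : M < U by apply/bigmax_ltP; split=> [|j _]; [lra | exact: LU].
exists ((M + U) / 2) => [j|]; last lra.
have : L j <= M by apply: le_bigmax.
lra.
Qed.

(** Gordan's alternative.  In the induction step a functional [m0] positive
    on all vectors but the first one, and not on the first one [a0], is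
    corrected by a functional positive on the combinations
    of [a0] and the [a_j] that lie in the kernel of [m0]. *)
Lemma gordan p (a : 'I_p -> 'rV[R]_n) :
  (exists m, forall i, 0 < pairR m (a i)) \/
  exists c : 'I_p -> R, [/\ forall i, 0 <= c i, exists i, 0 < c i &
    \sum_i c i *: a i = 0].
Proof.
elim: p a => [|p IH] a; first by left; exists 0; case.
case: (IH (fun j => a (lift ord0 j))) => [[m0 m0P]|[c [c0 [j cj] ca]]]; last first.
  right; exists (fun i => oapp c 0 (unlift ord0 i)); split.
  - by move=> i; case: unliftP => [k _|_] /=.
  - by exists (lift ord0 j); rewrite liftK.
  - rewrite big_ord_recl unlift_none scale0r add0r -[RHS]ca.
    by apply: eq_bigr => i _; rewrite liftK.
have [m0a|m0a] := ltP 0 (pairR m0 (a ord0)).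
  by left; exists m0 => i; case: (unliftP ord0 i) => [j ->|->].
have [a0|a0] := eqVneq (a ord0) 0.
  right; exists (fun i => (i == ord0)%:R); split.
  - by move=> i; rewrite ler0n.
  - by exists ord0; rewrite ltr01.
  - by rewrite big_ord_recl a0 scaler0 add0r big1 // => i _; rewrite scale0r.
(* The functional sought is [m1 + c *: m0]; only the choice of [m1] and [c]
   depends on the sign of [m0] on [a0]. *)
have combine m1 c : 0 < pairR m1 (a ord0) + c * pairR m0 (a ord0) ->
    (forall j, - pairR m1 (a (lift ord0 j)) / pairR m0 (a (lift ord0 j)) < c) ->
    exists m, forall i, 0 < pairR m (a i).
  move=> c0 cj; exists (m1 + c *: m0) => i; rewrite pairRDl pairRZl.
  case: (unliftP ord0 i) => [j ->|-> //].
  by have := cj j; rewrite ltr_pdivrMr // -subr_gt0 opprK addrC.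
have [m0a0|m0a0] := eqVneq (pairR m0 (a ord0)) 0.
  (* [m0] does not see [a0]: take [m1] positive on [a0], and [c] large. *)
  pose L j := - pairR (a ord0) (a (lift ord0 j)) / pairR m0 (a (lift ord0 j)).
  left; apply: (combine (a ord0) (\big[Order.max/0]_j L j + 1)).
    by rewrite m0a0 mulr0 addr0 pairR_gt0.
  move=> j; apply: (@le_lt_trans _ _ (\big[Order.max/0]_j L j)).
    exact: le_bigmax.
  by rewrite ltrDl.
have {m0a0} {}m0a : pairR m0 (a ord0) < 0 by rewrite lt_neqAle m0a0.
pose b j := pairR m0 (a (lift ord0 j)) *: a ord0 -
  pairR m0 (a ord0) *: a (lift ord0 j).
case: (IH b) => [[m1 m1P]|[c [c0 [j cj] cb]]].
  (* The vectors [a_j] bound [c] from below, [a0] bounds it from above, and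
     positivity of [m1] on the [b_j] says that these bounds are compatible. *)
  pose L j := - pairR m1 (a (lift ord0 j)) / pairR m0 (a (lift ord0 j)).
  have LU j : L j < - pairR m1 (a ord0) / pairR m0 (a ord0).
    rewrite /L ltr_pdivrMr // mulrAC ltr_ndivlMr //.
    have := m1P j; rewrite /b pairRBr !pairRZr; lra.
  left; have [d dL dU] := exists_between LU.
  apply: (combine m1 d) => //; move: dU; rewrite ltr_ndivlMr //; lra.
(* A relation between the [b_j] is one between [a0] and the [a_j]. *)
right; pose e i := oapp (fun j => - pairR m0 (a ord0) * c j)
  (\sum_j c j * pairR m0 (a (lift ord0 j))) (unlift ord0 i).
have e0 : 0 < e ord0.
  rewrite /e unlift_none /= (bigD1 j) //= ltr_wpDr ?mulr_gt0 //.
  by apply: sumr_ge0 => i _; rewrite mulr_ge0 // ltW.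
exists e; split.
- move=> i; case: (unliftP ord0 i) => [k ->|->]; last exact: ltW.
  by rewrite /e liftK mulr_ge0 // oppr_ge0 ltW.
- by exists ord0.
- rewrite big_ord_recl /e unlift_none /= scaler_suml -big_split -[RHS]cb.
  apply: eq_bigr => i _; rewrite /b liftK /= scalerBr !scalerA mulNr scaleNr.
  by rewrite [_ * c i]mulrC.
Qed.

End Gordan.

Section Cones.
Variables (R : realType) (n : nat).
Implicit Types (x y : 'rV[R]_n).

Definition spanned_cone p (w : 'I_p -> 'rV[R]_n) : set 'rV[R]_n :=
  [set x | exists a : 'I_p -> R, (forall i, 0 <= a i) /\ x = \sum_i a i *: w i].

Definition ray_of (w : 'rV[R]_n) : set 'rV[R]_n :=
  [set x | exists2 a : R, 0 <= a & x = a *: w].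

Section SpannedCone.
Variables (p : nat) (w : 'I_p -> 'rV[R]_n).

Lemma spanned_cone0 : spanned_cone w 0.
Proof. by exists (fun=> 0); split=> //; rewrite big1 // => i _; rewrite scale0r. Qed.

Lemma spanned_coneD x y :
  spanned_cone w x -> spanned_cone w y -> spanned_cone w (x + y).
Proof.
move=> [a [a0 ->]] [b [b0 ->]]; exists (fun i => a i + b i); split=> [i|].
  exact: addr_ge0.
by rewrite -big_split; apply: eq_bigr => i _; rewrite scalerDl.
Qed.

Lemma spanned_coneZ c x : 0 <= c -> spanned_cone w x -> spanned_cone w (c *: x).
Proof.
move=> c0 [a [a0 ->]]; exists (fun i => c * a i); split=> [i|].
  exact: mulr_ge0.
by rewrite scaler_sumr; apply: eq_bigr => i _; rewrite scalerA.
Qed.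

Lemma spanned_cone_gen i : spanned_cone w (w i).
Proof.
exists (fun j => (j == i)%:R); split=> [j|]; first by rewrite ler0n.
rewrite (bigD1 i) //= eqxx scale1r big1 ?addr0 // => j /negPf ->.
by rewrite scale0r.
Qed.

Lemma spanned_cone_sum (I : Type) (r : seq I) (P : pred I) (f : I -> 'rV[R]_n) :
  (forall i, P i -> spanned_cone w (f i)) ->
  spanned_cone w (\sum_(i <- r | P i) f i).
Proof.
move=> fP; elim/big_ind: _ => //; [exact: spanned_cone0 | exact: spanned_coneD].
Qed.

(** For a minimal generating family of a strictly convex cone, Gordan's
    alternative for the projections of the other generators along [w i]
    gives a functional that vanishes on [w i] and is positive on the other
    generators: a nontrivial relation between the projections would either
    express [w i] by the other generators or put a line in the cone. *)
Lemma irredundant_ray_face :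
  strictly_convex (spanned_cone w) ->
  (forall i, ~ spanned_cone (fun j => w (lift i j)) (w i)) ->
  forall i, face (ray_of (w i)) (spanned_cone w).
Proof.
move=> sc irr i.
have w0 j : w j != 0.
  apply/eqP => wj; apply: (irr j); rewrite wj.
  by exists (fun=> 0); split=> //; rewrite big1 // => l _; rewrite scale0r.
have q0 := pairR_gt0 (w0 i); set q := pairR (w i) (w i) in q0.
pose proj x := x - (pairR (w i) x / q) *: w i.
case: (gordan (fun j => proj (w (lift i j)))) => [[m' m'P]|[c [c0 [j cj] cb]]].
  pose m := m' - (pairR m' (w i) / q) *: w i.
  have mwi : pairR m (w i) = 0.
    by rewrite pairRBl pairRZl divfK ?subrr // gt_eqF.
  have mw j : 0 < pairR m (w (lift i j)).
    have := m'P j; rewrite /proj /m pairRBr pairRBl pairRZl pairRZr.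
    by congr (0 < _ - _); rewrite -mulrA mulrC [q^-1 * _]mulrC.
  have mge0 j : 0 <= pairR m (w j).
    by case: (unliftP i j) => [l ->|->]; [exact/ltW | rewrite mwi].
  exists m.
    move=> _ [a [a0 ->]]; rewrite pairR_sumr sumr_ge0 // => j _.
    by rewrite pairRZr mulr_ge0.
  apply/seteqP; split=> [_ [a a0 ->]|_ [[a [a0 ->]] /= e]].
    split=> /=; last by rewrite pairRZr mwi mulr0.
    exact/spanned_coneZ/spanned_cone_gen.
  exists (a i) => //; rewrite (bigD1_ord i) //= big1 ?addr0 // => j _.
  suff -> : a (lift i j) = 0 by rewrite scale0r.
  apply/eqP; rewrite -[_ == 0]orbF -(gt_eqF (mw j)) -mulf_eq0; apply/eqP.
  rewrite -pairRZr; move: e; rewrite pairR_sumr => /psumr_eq0P -> // l _.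
  by rewrite pairRZr mulr_ge0.
pose mu := \sum_l c l * (pairR (w i) (w (lift i l)) / q).
have cw : \sum_l c l *: w (lift i l) = mu *: w i.
  apply/eqP; rewrite -subr_eq0 -[X in _ == X]cb scaler_suml -sumrB; apply/eqP.
  by apply: eq_bigr => l _; rewrite /proj scalerBr scalerA.
case: (ltP 0 mu) => mu0.
  case: (irr i); exists (fun l => mu^-1 * c l); split=> [l|].
    by rewrite mulr_ge0 // invr_ge0 ltW.
  rewrite -[LHS]scale1r -(mulVf (lt0r_neq0 mu0)) -scalerA -cw scaler_sumr.
  by apply: eq_bigr => l _; rewrite scalerA.
case/eqP: (w0 (lift i j)); apply: sc; first exact: spanned_cone_gen.
have -> : - w (lift i j) = (c j)^-1 *:
    (\sum_(l | l != j) c l *: w (lift i l) + (- mu) *: w i).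
  apply: (scalerI (lt0r_neq0 cj)); rewrite scalerA mulfV ?lt0r_neq0 // scale1r.
  by rewrite scaleNr -cw [X in _ - X](bigD1 j) //= opprD addrCA subrr addr0 scalerN.
apply: spanned_coneZ; first by rewrite invr_ge0 ltW.
apply: spanned_coneD; last first.
  by apply: spanned_coneZ; [rewrite oppr_ge0 | exact: spanned_cone_gen].
by apply: spanned_cone_sum => l _; apply/spanned_coneZ/spanned_cone_gen.
Qed.

End SpannedCone.

(** Divide [w] by the largest integer that divides all its coordinates. *)
Lemma primitive_divisor (w : 'rV[int]_n) : w != 0 ->
  exists (w' : 'rV[int]_n) (d : nat), [/\ w = w' *+ d, (0 < d)%N & primitive w'].
Proof.
move=> w0; have [i wi] : exists i, w 0 i != 0.
  apply/not_existsP => e; case/eqP: w0; apply/rowP => i; rewrite mxE.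
  by apply/eqP; apply: contrapT => /negP; apply: e.
pose P d := `[< exists w' : 'rV[int]_n, w = w' *+ d >].
have P1 : exists d, P d by exists 1%N; apply/asboolP; exists w.
have Pb d : P d -> (d <= `|w 0%R i|)%N.
  move=> /asboolP[w' e]; apply: dvdn_leq; first by rewrite absz_gt0.
  have -> : w 0 i = w' 0 i * d%:Z.
    by rewrite e -scaler_nat mxE mulrC natz.
  by rewrite abszM absz_nat dvdn_mull.
case: (ex_maxnP P1 Pb) => d /asboolP[w' wE] dmax.
have d0 : (0 < d)%N by case: d wE {dmax} => // e; rewrite e mulr0n eqxx in w0.
exists w', d; split=> // w'' d' e.
have d'0 : (0 < d')%N by case: d' e => // e; rewrite wE e mul0rn eqxx in w0.
have : (d' * d <= d)%N by apply: dmax; apply/asboolP; exists w''; rewrite wE e -mulrnA.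
by rewrite -{2}[d]mul1n leq_pmul2r // => h; apply/eqP; rewrite eqn_leq h.
Qed.

(** With the least possible number of generators, none of them can be expressed
    by the others. *)
Lemma minimal_generators (sigma : set 'rV[R]_n) :
  rational_polyhedral_cone sigma ->
  exists (p : nat) (w : 'I_p -> 'rV[int]_n),
    sigma = spanned_cone (fun i => latR R (w i)) /\
    forall i, ~ spanned_cone (fun j => latR R (w (lift i j))) (latR R (w i)).
Proof.
move=> rat; pose P p := `[< exists w : 'I_p -> 'rV[int]_n,
  sigma = spanned_cone (fun i => latR R (w i)) >].
have [p0 [w0 e0]] := rat.
have exP : exists p, P p by exists p0; apply/asboolP; exists w0.
case: (ex_minnP exP) => p /asboolP[w wE] pmin; exists p, w; split=> // i red.
have p_gt0 : (0 < p)%N by apply: leq_ltn_trans (ltn_ord i).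
suff : P p.-1 by move=> /pmin; rewrite leqNgt prednK ?leqnn.
apply/asboolP; exists (fun j => w (lift i j)); rewrite wE.
apply/seteqP; split=> [_ [a [a0 ->]]|_ [a [a0 ->]]].
  rewrite (bigD1_ord i) //=; apply: spanned_coneD; first exact: spanned_coneZ.
  apply: spanned_cone_sum => j _; apply: spanned_coneZ => //.
  exact: (spanned_cone_gen (fun j => latR R (w (lift i j)))).
apply: spanned_cone_sum => j _; apply: spanned_coneZ => //.
exact: (spanned_cone_gen (fun i => latR R (w i))).
Qed.

End Cones.

Section FanRays.
Variables (R : realType) (n : nat) (F : fan R n).
Implicit Types (sigma tau : cone_of F).

Lemma cone_ofP sigma : cones F (val sigma).
Proof. exact: set_mem (valP sigma). Qed.

Lemma cone_has0 sigma : val sigma 0.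
Proof.
have [p [w ->]] := fan_rational (cone_ofP sigma).
by exists (fun=> 0); split=> //; rewrite big1 // => i _; rewrite scale0r.
Qed.

Lemma cone_face_refl sigma : face (val sigma) (val sigma).
Proof.
by have [+ _] := fan_inter (cone_ofP sigma) (cone_ofP sigma); rewrite setIid.
Qed.

Lemma zero_cone_face sigma : face (val (zero_cone F)) (val sigma).
Proof.
have [+ _] := fan_inter (cone_ofP sigma) (fan_zero F); congr face.
by apply/seteqP; split=> [x []//|x ->]; split=> //; apply: cone_has0.
Qed.

Lemma face_sub (tau sigma : set 'rV[R]_n) : face tau sigma -> tau `<=` sigma.
Proof. by move=> [m _ ->] x []. Qed.

(** Minimal rational generators of a cone span faces of it, hence cones of the
    fan, and may be replaced by primitive vectors. *)
Lemma cone_rays sigma :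
  exists (p : nat) (rho : 'I_p -> cone_of F) (w : 'I_p -> 'rV[int]_n),
    (forall i, face (val (rho i)) (val sigma) /\
               primitive_generator (val (rho i)) (w i)) /\
    val sigma `<=` spanned_cone (fun i => latR R (w i)).
Proof.
have [p [w [sE irr]]] := minimal_generators (fan_rational (cone_ofP sigma)).
have sc := fan_strict (cone_ofP sigma); rewrite sE in sc.
have rayP i : exists rw : cone_of F * 'rV[int]_n,
    (face (val rw.1) (val sigma) /\ primitive_generator (val rw.1) rw.2) /\
    exists2 d : R, 0 <= d & latR R (w i) = d *: latR R rw.2.
  have fi := irredundant_ray_face sc irr i; rewrite -sE in fi.
  have w0 : w i != 0.
    apply/eqP => e; apply: (irr i); rewrite e /latR map_mx0.
    exact: spanned_cone0.
  have [w' [d [wE d0 w'P]]] := primitive_divisor w0.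
  have latE : latR R (w i) = d%:R *: latR R w'.
    rewrite wE /latR scaler_nat; apply/rowP => j.
    by rewrite !mxE /= !mulmxnE mxE rmorphMn.
  exists (exist (fun s => s \in cones F) _ (mem_set (fan_face (cone_ofP sigma) fi)), w').
  split; last by exists d%:R; rewrite ?ler0n.
  split=> //; split=> //=; rewrite /ray_of latE.
  have dR : (d%:R : R) != 0 by rewrite pnatr_eq0 -lt0n.
  apply/seteqP; split=> [_ [a a0 ->]|_ [a a0 ->]].
    by exists (a * d%:R); rewrite ?scalerA // mulr_ge0 ?ler0n.
  by exists (a / d%:R); rewrite ?scalerA ?divfK // mulr_ge0 ?invr_ge0 ?ler0n.
have [rw rwP] := choice rayP.
exists p, (fun i => (rw i).1), (fun i => (rw i).2); split=> [i|x].
  by have [] := rwP i.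
rewrite sE => -[a [a0 ->]]; apply: spanned_cone_sum => i _.
have [_ [d d0 ->]] := rwP i; rewrite scalerA.
apply: spanned_coneZ; first exact: mulr_ge0.
exact: (spanned_cone_gen (fun i => latR R (rw i).2)).
Qed.

End FanRays.

(** * Coordinate rings of the charts *)

Lemma big_regroup (G : nmodType) (I J : eqType) (g : I -> J)
    (r : seq I) (f : I -> G) :
  \sum_(i <- r) f i = \sum_(j <- undup (map g r)) \sum_(i <- r | g i == j) f i.
Proof.
rewrite (exchange_big_dep xpredT) //=; apply: eq_big_seq => i ir.
rewrite -big_filter (eq_filter (a2 := pred1 (g i))) => [|j]; last exact: eq_sym.
by rewrite filter_pred1_uniq ?undup_uniq ?mem_undup ?map_f // big_seq1.
Qed.

(** The radical of an ideal is an ideal, so it contains 1 as soon as it contains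
    generators of the unit ideal.  This turns local statements on the open
    subsets where the [f i] are invertible into global ones. *)
Lemma unit_ideal_powers (A : comNzRingType) (P : A -> Prop) :
  P 0 -> (forall a b, P a -> P b -> P (a + b)) ->
  (forall a b, P b -> P (a * b)) ->
  forall (q : nat) (f g : 'I_q -> A), \sum_i g i * f i = 1 ->
  (forall i, exists N, P (f i ^+ N)) -> P 1.
Proof.
move=> P0 PD PM q f g gf fP.
suff [N] : exists N, P ((\sum_i g i * f i) ^+ N) by rewrite gf expr1n.
apply: (big_ind (fun a => exists N, P (a ^+ N))) => [|a b [N aN] [M bM]|i _].
- by exists 1%N; rewrite expr1.
- exists (N + M)%N; rewrite exprDn; apply: (big_ind P) => // i _.
  rewrite -mulr_natl; apply: (PM); have [Mi|Mi] := leqP M i.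
    by rewrite -(subnK Mi) exprD mulrA; apply: PM.
  have Ni : (N <= N + M - i)%N by rewrite -addnBA ?leq_addr // ltnW.
  by rewrite -(subnK Ni) exprD mulrAC; apply: PM.
- by have [N fN] := fP i; exists N; rewrite exprMn; apply: PM.
Qed.

Section CoordinateRings.
Variables (R : realType) (k : fieldType) (n : nat).
Implicit Types (sigma tau : set 'rV[R]_n) (m u : 'rV[int]_n).
Local Notation A sigma := (coordRing k sigma).
Local Notation regular sigma := (@regular_pred R k n sigma).

Lemma monomials_zero_cone m : monomials [set 0 : 'rV[R]_n] m.
Proof. by move=> x ->; rewrite pairR0r. Qed.

Lemma monomials_perp sigma m :
  (forall x, sigma x -> charR m x = 0) -> monomials sigma m.
Proof. by move=> m0 x /m0; rewrite /charR => ->. Qed.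

Lemma regular_chi sigma m : monomials sigma m ->
  @chi k n m \in regular sigma.
Proof.
move=> mS; apply/asboolP; exists 1%N, (fun=> 1), (fun=> m); split=> //.
by apply/funext => t; rewrite big_ord1 mul1r.
Qed.

Definition chiA sigma m (mS : monomials sigma m) : A sigma :=
  CoordRing (regular_chi mS).

Definition chiT m : A [set 0 : 'rV[R]_n] := chiA (monomials_zero_cone m).

Lemma regular_sub sigma tau (f : torus k n -> k) : tau `<=` sigma ->
  f \in regular sigma -> f \in regular tau.
Proof.
move=> ts /asboolP[p [c [m [mS ->]]]]; apply/asboolP; exists p, c, m; split=> //.
by move=> i x /ts; apply: mS.
Qed.

Lemma regular_zero_cone sigma (f : torus k n -> k) :
  f \in regular sigma -> f \in regular [set 0 : 'rV[R]_n].
Proof.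
move=> /asboolP[p [c [m [mS ->]]]]; apply/asboolP; exists p, c, m; split=> // i.
exact: monomials_zero_cone.
Qed.

(** Restriction to the open orbit: elements of the coordinate rings are already
    represented by functions on the torus, so only the ring changes. *)
Definition toT sigma (f : A sigma) : A [set 0 : 'rV[R]_n] :=
  CoordRing (regular_zero_cone (regfunP f)).

Lemma coordRing_eq sigma (f g : A sigma) : (forall t, f t = g t) -> f = g.
Proof. by move=> fg; apply/val_inj/funext. Qed.

Lemma coordRingM sigma (f g : A sigma) t : (f * g) t = f t * g t.
Proof. by []. Qed.

Lemma coordRingX sigma (f : A sigma) N t : (f ^+ N) t = f t ^+ N.
Proof. by elim: N => // N IH; rewrite !exprS coordRingM IH. Qed.

Lemma coordRing_eqP sigma (f g : A sigma) t : f = g -> f t = g t.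
Proof. by move=> ->. Qed.

Lemma toTE sigma (f : A sigma) t : toT f t = f t.
Proof. by []. Qed.

Lemma chiTE m t : chiT m t = chi m t.
Proof. by []. Qed.

Lemma toT0 sigma : toT (0 : A sigma) = 0.
Proof. exact: coordRing_eq. Qed.

Lemma toT1 sigma : toT (1 : A sigma) = 1.
Proof. exact: coordRing_eq. Qed.

Lemma toTD sigma (f g : A sigma) : toT (f + g) = toT f + toT g.
Proof. exact: coordRing_eq. Qed.

Lemma toTB sigma (f g : A sigma) : toT (f - g) = toT f - toT g.
Proof. exact: coordRing_eq. Qed.

Lemma toTM sigma (f g : A sigma) : toT (f * g) = toT f * toT g.
Proof. exact: coordRing_eq. Qed.

Fact cstA_is_zmod_morphism sigma : zmod_morphism (@cstA R k n sigma).
Proof. by move=> a b; apply: coordRing_eq. Qed.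
Fact cstA_is_monoid_morphism sigma : monoid_morphism (@cstA R k n sigma).
Proof. by split=> [|a b]; apply: coordRing_eq. Qed.
HB.instance Definition _ sigma :=
  GRing.isZmodMorphism.Build k (A sigma) (@cstA R k n sigma)
    (@cstA_is_zmod_morphism sigma).
HB.instance Definition _ sigma :=
  GRing.isMonoidMorphism.Build k (A sigma) (@cstA R k n sigma)
    (@cstA_is_monoid_morphism sigma).

Lemma cstAM sigma (a b : k) :
  cstA sigma (a * b) = cstA sigma a * cstA sigma b :> A sigma.
Proof. exact: rmorphM. Qed.

Lemma chi_mul_eq0 sigma (f a : A sigma) m :
  f = @chi k n m :> (torus k n -> k) -> f * a = 0 -> a = 0.
Proof.
move=> fE fa; apply: coordRing_eq => t; apply: (mulfI (chi_neq0 m t)).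
by rewrite -fE -coordRingM fa mulr0.
Qed.

Lemma regular_seqP sigma (f : torus k n -> k) :
  f \in regular sigma <->
  exists l : seq ('rV[int]_n * k), (forall p, p \in l -> monomials sigma p.1) /\
    forall t, f t = \sum_(p <- l) chi p.1 t * p.2.
Proof.
split=> [/asboolP[p [c [m [mS ->]]]]|[l [lS fE]]].
  exists [seq (m i, c i) | i <- index_enum 'I_p].
  split=> [_ /mapP[i _ ->]/=|t]; first exact: mS.
  by rewrite big_map; apply: eq_bigr => i _; rewrite mulrC.
apply/asboolP; exists (size l), (fun i => (tnth (in_tuple l) i).2).
exists (fun i => (tnth (in_tuple l) i).1); split=> [i|].
  exact/lS/mem_tnth.
by apply/funext => t; rewrite fE big_tnth; apply: eq_bigr => i _; rewrite mulrC.
Qed.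

Hypothesis k_char0 : [pchar k] =i pred0.

(** The exponents of a Laurent polynomial with nonzero coefficients are
    determined by the function, so membership in the coordinate
    ring can be tested one exponent at a time, and an exponent is
    in the dual of a cone when it is nonnegative on generators. *)
Lemma regular_on_generators sigma p (rho : 'I_p -> set 'rV[R]_n)
    (w : 'I_p -> 'rV[R]_n) (f : torus k n -> k) :
  sigma `<=` spanned_cone w -> (forall i, rho i (w i)) ->
  f \in regular [set 0 : 'rV[R]_n] ->
  (forall i, f \in regular (rho i)) -> f \in regular sigma.
Proof.
move=> sw rw /regular_seqP[l [_ fE]] frho.
(* The coefficient function; exponents may be repeated in a list. *)
pose coef (l : seq ('rV[int]_n * k)) m := \sum_(p <- l | p.1 == m) p.2.
have coefP m i : coef l m != 0 -> monomials (rho i) m.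
  have /regular_seqP[l' [l'S fE']] := frho i.
  have /chi_independent -/(_ k_char0 m) :
      forall t, \sum_(p <- l ++ [seq (p.1, - p.2) | p <- l'])
        (idfun (chi p.1 t) : k) *: (p.2 : k^o) = 0.
    move=> t; rewrite big_cat big_map /= -fE.
    under [X in _ + X]eq_bigr => q _ do rewrite scalerN.
    by rewrite sumrN -fE' subrr.
  rewrite big_cat big_map /= sumrN => /eqP; rewrite subr_eq0 => /eqP.
  rewrite -/(coef l m) => -> c0.
  have /hasP[q ql' /eqP <-] : has (fun q => q.1 == m) l'.
    apply: contraNT c0 => /hasPn h; rewrite big_seq_cond big1 // => q /andP[/h].
    by move/negPf ->.
  exact: l'S.
apply/regular_seqP.
exists [seq (m, coef l m) | m <- undup (map fst l) & coef l m != 0]; split.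
  move=> q /mapP[m]; rewrite mem_filter => /andP[cm _] -> x /sw[a [a0 ->]] /=.
  rewrite pairR_sumr sumr_ge0 // => i _; rewrite pairRZr mulr_ge0 //.
  exact: (coefP m i cm).
move=> t; rewrite fE (big_regroup fst) big_map big_filter [RHS]big_mkcond.
apply: eq_bigr => m _ /=; transitivity (chi m t * coef l m).
  by rewrite mulr_sumr; apply: eq_bigr => q /eqP ->.
by case: ifPn => // /negPn/eqP ->; rewrite mulr0.
Qed.

End CoordinateRings.

(** * Extension of sections from the rays of a chart *)

Section VectorBundleSections.
Variables (R : realType) (k : fieldType) (n : nat) (F : fan R n).
Variable V : vectorBundle k F.
Local Notation A sigma := (coordRing k (val (sigma : cone_of F))).
Local Notation o := (zero_cone F).
Implicit Types (sigma tau : cone_of F).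

Section Restriction.
Variables (sigma tau : cone_of F) (st : face (val tau) (val sigma)).

Lemma res_zmod_morphism : {morph @res _ _ _ _ V sigma tau : s s' / s - s'}.
Proof.
move=> s s'; rewrite -[s' in LHS]scale1r -scaleNr resD //.
rewrite (resZ st (g := -1)) ?scaleN1r //.
Qed.

Lemma res0 : res tau (0 : sec V sigma) = 0.
Proof. by rewrite -(subrr 0) res_zmod_morphism subrr. Qed.

Lemma res_sum (I : Type) (r : seq I) (P : pred I) (f : I -> sec V sigma) :
  res tau (\sum_(i <- r | P i) f i) = \sum_(i <- r | P i) res tau (f i).
Proof. exact: (big_morph _ (resD st) res0). Qed.

End Restriction.

Lemma res_toT sigma (f : A sigma) (s : sec V sigma) :
  res o (f *: s) = toT f *: res o s.
Proof. exact: (resZ (zero_cone_face sigma)). Qed.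

Lemma res_cstA sigma (c : k) (s : sec V sigma) :
  res o (cstA (val sigma) c *: s) = cstA (val o) c *: res o s.
Proof. exact: (resZ (zero_cone_face sigma)). Qed.

(** Sections of a locally free sheaf are torsion-free, and restriction to the
    open orbit inverts only monomials, which are not zero divisors. *)
Lemma res_zero_inj sigma (s : sec V sigma) : res o s = 0 -> s = 0.
Proof.
move=> /(res_ker (zero_cone_face sigma))[m [chim [_ chimE chims]]].
have [q [f [g [gf loc]]]] := sec_locally_free V sigma.
rewrite -[s]scale1r.
apply: (unit_ideal_powers (P := fun a => a *: s = 0) _ _ _ gf).
- exact: scale0r.
- by move=> a b sa sb; rewrite scalerDl sa sb addr0.
- by move=> a b sb; rewrite -scalerA sb scaler0.
move=> i; have [r [b [gen rel]]] := loc i; have [N [c cE]] := gen s.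
have [|N' N'P] := rel (fun j => chim * c j).
  under eq_bigr => j _ do rewrite -scalerA.
  by rewrite -scaler_sumr -cE scalerA mulrC -scalerA chims scaler0.
exists (N' + N)%N; rewrite exprD -scalerA cE scaler_sumr big1 // => j _.
rewrite scalerA (chi_mul_eq0 chimE (a := f i ^+ N' * c j)) ?scale0r //.
by rewrite mulrCA N'P.
Qed.

(** Clearing the denominator of a section over a face [tau] of [sigma], then
    expressing it in the basis of a trivializing open subset of [U_sigma]. *)
Lemma local_expansion sigma tau (f : A sigma) (r : nat)
    (b : 'I_r -> sec V sigma) (s : sec V o) (st : sec V tau) :
  face (val tau) (val sigma) ->
  (forall s, exists (N : nat) (c : 'I_r -> A sigma),
     f ^+ N *: s = \sum_j c j *: b j) ->
  res o st = s ->
  exists m N (c : 'I_r -> A sigma) (chim : A sigma),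
    [/\ forall x, val tau x -> charR m x = 0,
        forall t, chim t = chi m t &
        toT (chim * f ^+ N) *: s = \sum_j toT (c j) *: res o (b j)].
Proof.
move=> ts gen <-; have [m [fm [s' [mS m0 fmE s'E]]]] := res_frac ts st.
have [N [c cE]] := gen s'; exists m, N, c, (chiA k mS); split=> //.
have := congr1 (res o) s'E.
rewrite (res_comp ts (zero_cone_face tau)) res_toT => e.
rewrite mulrC toTM -scalerA.
have -> : toT (chiA k mS) = toT fm by apply: coordRing_eq => t; rewrite /= fmE.
rewrite e -res_toT cE (res_sum (zero_cone_face sigma)).
by apply: eq_bigr => j _; rewrite res_toT.
Qed.

Hypothesis k_char0 : [pchar k] =i pred0.

(** A Hartogs-type extension: a section over the open orbit that extends over
    the charts of all the rays of [sigma] extends over the chart of [sigma].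
    On an open subset where the bundle is trivial, its coordinates become
    regular on each ray after multiplication by a power of the function
    defining the open subset. *)
Lemma extend_from_rays sigma p (rho : 'I_p -> cone_of F)
    (w : 'I_p -> 'rV[R]_n) (s : sec V o) :
  (forall i, face (val (rho i)) (val sigma)) -> (forall i, val (rho i) (w i)) ->
  val sigma `<=` spanned_cone w ->
  (forall i, exists s' : sec V (rho i), res o s' = s) ->
  exists s' : sec V sigma, res o s' = s.
Proof.
move=> rs rw sw srho; rewrite -[s]scale1r -(toT1 k (val sigma)).
have [q [f [g [gf loc]]]] := sec_locally_free V sigma.
have so := zero_cone_face sigma.
apply: (unit_ideal_powers
  (P := fun a => exists s' : sec V sigma, res o s' = toT a *: s) _ _ _ gf).
- by exists 0; rewrite res0 // toT0 scale0r.
- move=> a b [sa ea] [sb eb]; exists (sa + sb).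
  by rewrite resD // ea eb toTD scalerDl.
- by move=> a b [sb eb]; exists (a *: sb); rewrite res_toT eb scalerA -toTM.
move=> i; have [r [b [gen rel]]] := loc i.
have [m0 [N0 [c0 [chim0 [_ chim0E e0]]]]] := local_expansion so gen (res_id s).
(* [d j / f i ^+ N0] is the j-th coordinate of [s] over the orbit. *)
pose d j : torus k n -> k := fun t => c0 j t * chi (- m0) t.
have dreg l : exists K, forall j, (fun t => (f i t) ^+ K * d j t) \in
    regular_pred (val (rho l)).
  have [s' s'E] := srho l.
  have [m [N [c [chim [mperp chimE e]]]]] := local_expansion (rs l) gen s'E.
  (* Comparing the expansions over the orbit and over the ray. *)
  pose D j := chim * f i ^+ N * c0 j - chim0 * f i ^+ N0 * c j.
  have [|N' N'P] := rel D.
    apply: res_zero_inj; rewrite (res_sum so).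
    under eq_bigr => j _ do rewrite res_toT toTB scalerBl ![toT (_ * _)]toTM.
    rewrite sumrB; under eq_bigr => j _ do rewrite -scalerA.
    under [X in _ - X]eq_bigr => j _ do rewrite -scalerA.
    rewrite -!scaler_sumr -e0 -e !scalerA.
    by rewrite -!toTM [X in toT X]mulrC subrr.
  exists (N' + N)%N => j; pose h : torus k n -> k := f i ^+ (N' + N0) * c j.
  have -> : (fun t => f i t ^+ (N' + N) * d j t) = h * @chi k n (- m).
    apply/funext => t; transitivity (h t * chi (- m) t) => //; rewrite /h /d.
    rewrite coordRingM coordRingX !exprD.
    have := N'P j; rewrite /D mulrBr => /eqP.
    rewrite subr_eq0 => /eqP/(coordRing_eqP t).
    rewrite !(coordRingM, coordRingX) chimE chim0E.
    have := chiNK m0 t; have := chiNK m t.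
    move: (chi m t) (chi m0 t) (chi (- m) t) (chi (- m0) t) => x x0 y y0.
    move: (f i t ^+ N) (f i t ^+ N') (f i t ^+ N0) (c j t) (c0 j t).
    move=> fN fN' fN0 cj cj0 xy xy0 e1.
    transitivity (fN' * (x * fN * cj0) * (y * y0)).
      by rewrite -[LHS]mulr1 -xy; ring.
    by rewrite e1 -[RHS]mulr1 -xy0; ring.
  apply: rpredM; last first.
    apply: regular_chi; apply: monomials_perp => x /mperp.
    by rewrite charRN => ->; rewrite oppr0.
  exact: regular_sub (face_sub (rs l)) (regfunP _).
have [K KP] := choice dreg; pose M := (\sum_l K l)%N.
have hreg j : (fun t => (f i t) ^+ M * d j t) \in regular_pred (val sigma).
  apply: (regular_on_generators k_char0 sw rw) => [|l].
    have -> : (fun t => f i t ^+ M * d j t) =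
        toT (f i ^+ M * c0 j) * chiT R k (- m0) :> (torus k n -> k).
      apply/funext => t.
      transitivity ((f i ^+ M * c0 j : A sigma) t * chi (- m0) t) => //.
      by rewrite coordRingM coordRingX /d mulrA.
    exact: regfunP.
  have KM : (K l <= M)%N by rewrite /M (bigD1 l) //= leq_addr.
  pose h : torus k n -> k := f i ^+ (M - K l).
  have -> : (fun t => f i t ^+ M * d j t) = h * (fun t => f i t ^+ K l * d j t).
    apply/funext => t; transitivity (h t * (f i t ^+ K l * d j t)) => //; rewrite /h.
    by rewrite coordRingX mulrA -exprD subnK.
  apply: rpredM; last exact: KP.
  exact: regular_sub (face_sub (rs l)) (regfunP _).
exists (M + N0)%N; exists (\sum_j CoordRing (hreg j) *: b j).
rewrite (res_sum so).
have -> : toT (f i ^+ (M + N0)) =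
    toT (f i ^+ M) * chiT R k (- m0) * toT (chim0 * f i ^+ N0).
  apply: coordRing_eq => t.
  transitivity (f i t ^+ M * chi (- m0) t * (chi m0 t * f i t ^+ N0)).
    rewrite toTE coordRingX exprD -!mulrA; congr (_ * _).
    by rewrite mulrA [chi (- _) t * _]mulrC chiNK mul1r.
  by rewrite coordRingM [in RHS]coordRingM !toTE chiTE coordRingM !coordRingX chim0E.
rewrite -scalerA e0 scaler_sumr; apply: eq_bigr => j _.
rewrite res_toT scalerA; congr (_ *: _); apply: coordRing_eq => t.
by rewrite [in RHS]coordRingM coordRingM !toTE chiTE coordRingX /= /d mulrAC -!mulrA.
Qed.

End VectorBundleSections.

(** * Weight spaces and the fiber over the open orbit *)

Section Weights.
Variables (R : realType) (k : fieldType) (n : nat) (F : fan R n).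
Variable V : toricBundle k F.
Local Notation A sigma := (coordRing k (val (sigma : cone_of F))).
Local Notation o := (zero_cone F).
Implicit Types (sigma tau : cone_of F) (t : torus k n).

Section Chart.
Variable sigma : cone_of F.
Implicit Types (s : sec V sigma).

Lemma act_cst t (c : k) s :
  act t (cstA (val sigma) c *: s) = cstA (val sigma) c *: act t s.
Proof. exact: actZ. Qed.

Lemma act0 t : act t (0 : sec V sigma) = 0.
Proof. by have := act_cst t 0 0; rewrite rmorph0 !scale0r. Qed.

Lemma act_sum t (I : Type) (r : seq I) (P : pred I) (f : I -> sec V sigma) :
  act t (\sum_(i <- r | P i) f i) = \sum_(i <- r | P i) act t (f i).
Proof. exact: (big_morph _ (actD t) (act0 t)). Qed.

Lemma weight_sec0 u : weight_sec u (0 : sec V sigma).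
Proof. by move=> t; rewrite act0 scaler0. Qed.

Lemma weight_secD u s s' :
  weight_sec u s -> weight_sec u s' -> weight_sec u (s + s').
Proof. by move=> us us' t; rewrite actD us us' scalerDr. Qed.

Lemma weight_secZ u c s :
  weight_sec u s -> weight_sec u (cstA (val sigma) c *: s).
Proof. by move=> us t; rewrite act_cst us !scalerA mulrC. Qed.

Lemma weight_secB u s s' :
  weight_sec u s -> weight_sec u s' -> weight_sec u (s - s').
Proof.
move=> us us'; apply: weight_secD us _; have := weight_secZ (-1) us'.
by rewrite rmorphN1 scaleN1r.
Qed.

Lemma weight_sec_sum u (I : eqType) (r : seq I) (P : pred I)
    (f : I -> sec V sigma) :
  (forall i, i \in r -> P i -> weight_sec u (f i)) ->
  weight_sec u (\sum_(i <- r | P i) f i).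
Proof.
move=> fP; rewrite big_seq_cond; elim/big_ind: _ => [||i /andP[]].
- exact: weight_sec0.
- exact: weight_secD.
- exact: fP.
Qed.

(** The function [chi m] has weight [- m]. *)
Lemma weight_sec_chi u m (mS : monomials (val sigma) m) s :
  weight_sec u s -> weight_sec (u - m) (chiA k mS *: s).
Proof.
move=> us t; rewrite (actZ (g := cstA _ (chi (- m) t) * chiA k mS)).
  rewrite us !scalerA addrC chiD rmorphM /= -!mulrA; congr (_ *: _).
  by congr (_ * _); rewrite mulrC.
move=> x; rewrite coordRingM /= chiM chiV; congr (_ * _).
Qed.

Hypothesis k_char0 : [pchar k] =i pred0.

(** The coefficients of the algebraic action [t . s], collected by
    character, are the weight components of [s]. *)
Lemma weight_decomposition s :
  exists l : seq ('rV[int]_n * sec V sigma),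
    (forall p, p \in l -> weight_sec p.1 p.2) /\ s = \sum_(p <- l) p.2.
Proof.
have [p [u [s' sE]]] := act_algebraic s.
pose comp w := \sum_(i <- index_enum 'I_p | u i == w) s' i.
exists [seq (w, comp w) | w <- undup (map u (index_enum 'I_p))]; split.
  move=> _ /mapP[w _ ->] /= t; apply/eqP; rewrite -subr_eq0 /comp act_sum.
  rewrite scaler_sumr -sumrB.
  (* The two ways to compute [(t t') . s], as functions of [t']. *)
  pose l := [seq (u i, act t (s' i) - cstA _ (chi (u i) t) *: s' i) |
              i <- index_enum 'I_p].
  have l0 t' : \sum_(q <- l) cstA _ (chi q.1 t') *: q.2 = 0.
    rewrite big_map /=; under eq_bigr => i _ do rewrite scalerBr -act_cst scalerA.
    rewrite sumrB -act_sum -sE -actM torus_mulC sE; apply/eqP.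
    rewrite subr_eq0; apply/eqP; apply: eq_bigr => i _.
    by rewrite chiM rmorphM.
  have := chi_independent k_char0 l0 w; rewrite big_map /= => e.
  by rewrite -[X in _ == X]e; apply/eqP/eq_bigr => i /eqP ->.
rewrite big_map -(act1 s) sE.
have c1 i : cstA (val sigma) (chi (u i) 1%g) *: s' i = s' i.
  by rewrite (chi1 k (u i)) rmorph1 scale1r.
transitivity (\sum_i s' i); first by apply: eq_bigr => i _; apply: c1.
exact: big_regroup.
Qed.

End Chart.

Lemma weight_sec_chiT u m (s : sec V o) :
  weight_sec u s -> weight_sec (u - m) (chiT R k m *: s).
Proof. exact: (weight_sec_chi (sigma := o) (monomials_zero_cone m)). Qed.

Hypothesis k_char0 : [pchar k] =i pred0.

(** On the open orbit all weight spaces are identified with the one of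
    weight [u] by means of the invertible functions [chi m], so a section
    becomes a function on the torus with values in that weight space;
    [orbit_values u s psi] says that this function is [psi]. *)
Definition orbit_values u (s : sec V o) (psi : torus k n -> sec V o) :=
  exists l : seq ('rV[int]_n * sec V o),
    [/\ forall p, p \in l -> weight_sec u p.2,
        s = \sum_(p <- l) chiT R k p.1 *: p.2 &
        forall t, psi t = \sum_(p <- l) cstA (val o) (chi p.1 t) *: p.2].

Lemma orbit_values_exists u s : exists psi, orbit_values u s psi.
Proof.
have [l [lP ->]] := weight_decomposition k_char0 s.
pose l' := [seq (u - p.1, chiT R k (p.1 - u) *: p.2) | p <- l].
exists (fun t => \sum_(p <- l') cstA (val o) (chi p.1 t) *: p.2), l'; split=> //.
  move=> _ /mapP[p /lP pw ->] /=.
  by have := weight_sec_chiT (p.1 - u) pw; rewrite opprB addrC addrNK.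
rewrite big_map; apply: eq_bigr => p _ /=; rewrite scalerA.
rewrite (_ : _ * _ = 1) ?scale1r //; apply: coordRing_eq => t.
by rewrite coordRingM !chiTE -opprB mulrC chiNK.
Qed.

Lemma orbit_values_weight u s : weight_sec u s -> orbit_values u s (fun=> s).
Proof.
move=> us; exists [:: (0, s)]; split=> [p|| t].
- by rewrite inE => /eqP ->.
- rewrite big_seq1 (_ : chiT _ _ _ = 1) ?scale1r //.
  by apply: coordRing_eq => t; rewrite chiTE chi0.
- by rewrite big_seq1 chi0 rmorph1 scale1r.
Qed.

Lemma orbit_valuesD u s s' psi psi' :
  orbit_values u s psi -> orbit_values u s' psi' ->
  orbit_values u (s + s') (fun t => psi t + psi' t).
Proof.
move=> [l [lP -> lE]] [l' [lP' -> lE']]; exists (l ++ l'); split=> [p||t].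
- by rewrite mem_cat => /orP[/lP|/lP'].
- by rewrite big_cat.
- by rewrite lE lE' big_cat.
Qed.

Lemma orbit_values0 u : orbit_values u 0 (fun=> 0).
Proof. by exists [::]; split=> // [|t]; rewrite big_nil. Qed.

Lemma orbit_values_monomial u c m s psi : orbit_values u s psi ->
  orbit_values u ((cstA (val o) c * chiT R k m) *: s)
    (fun t => cstA (val o) (c * chi m t) *: psi t).
Proof.
move=> [l [lP -> lE]]; exists [seq (m + p.1, cstA (val o) c *: p.2) | p <- l].
split=> [_ /mapP[p /lP pw ->]||t]; first exact: weight_secZ.
- rewrite scaler_sumr big_map; apply: eq_bigr => p _ /=; rewrite !scalerA.
  congr (_ *: _); apply: coordRing_eq => t.
  by rewrite !coordRingM !chiTE chiD -mulrA mulrC.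
- rewrite lE scaler_sumr big_map; apply: eq_bigr => p _ /=.
  rewrite !scalerA; congr (_ *: _); apply: coordRing_eq => t0.
  by rewrite !coordRingM /= chiD -mulrA mulrC.
Qed.

Lemma orbit_values_sum u (I : Type) (r : seq I) (s : I -> sec V o) psi :
  (forall i, orbit_values u (s i) (psi i)) ->
  orbit_values u (\sum_(i <- r) s i) (fun t => \sum_(i <- r) psi i t).
Proof.
move=> sP; elim: r => [|i r IH].
  rewrite big_nil (_ : (fun t => _) = fun=> 0); first exact: orbit_values0.
  by apply/funext => t; rewrite big_nil.
rewrite big_cons (_ : (fun t => _) = fun t => psi i t + \sum_(j <- r) psi j t).
  exact: orbit_valuesD.
by apply/funext => t; rewrite big_cons.
Qed.

Lemma orbit_values_scale u (f : A o) s psi : orbit_values u s psi ->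
  orbit_values u (f *: s) (fun t => cstA (val o) (f t) *: psi t).
Proof.
move=> sP; have [l [_ fE]] := (regular_seqP _ _).1 (regfunP f).
have := orbit_values_sum l (fun p => orbit_values_monomial p.2 p.1 sP).
rewrite -scaler_suml; congr (orbit_values _ (_ *: _) _).
  apply: coordRing_eq => t; rewrite fE.
  elim: l {fE} => [|p l IH]; first by rewrite !big_nil.
  by rewrite !big_cons -IH mulrC.
apply/funext => t; rewrite fE rmorph_sum scaler_suml; apply: eq_bigr => p _.
by rewrite [p.2 * _]mulrC.
Qed.

(** If a combination of the [chi m] with coefficients of weight [u] is zero, then
    letting the torus act shows that every coefficient is zero, since the terms
    have distinct weights. *)
Lemma orbit_values_unique u s psi psi' :
  orbit_values u s psi -> orbit_values u s psi' -> psi =1 psi'.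
Proof.
move=> sP sP' t; apply/eqP; rewrite -subr_eq0.
have := orbit_valuesD sP (orbit_values_scale (-1) sP').
rewrite scaleN1r subrr => -[l [lP l0 lE]].
have {lE} -> : psi t - psi' t = \sum_(p <- l) cstA (val o) (chi p.1 t) *: p.2.
  by rewrite -lE rmorphN1 scaleN1r.
have comp0 m : \sum_(p <- l | p.1 == m) p.2 = 0.
  pose l' := [seq (p.1, chiT R k p.1 *: p.2) | p <- l].
  have /(chi_independent k_char0) -/(_ m) : forall t,
      \sum_(p <- l') cstA (val o) (chi p.1 t) *: p.2 = 0.
    move=> t'; pose c := cstA (val o) (chi (- u) t'^-1%g) : A o.
    have : c *: act t'^-1%g (\sum_(p <- l) chiT R k p.1 *: p.2) = 0.
      by rewrite -l0 act0 scaler0.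
    rewrite act_sum scaler_sumr big_map => e; rewrite -[RHS]e.
    apply: eq_big_seq => p pl /=.
    have -> := weight_sec_chiT p.1 (lP p pl).
    rewrite /c [RHS]scalerA -cstAM -chiD addKr.
    by rewrite /= chiV opprK.
  rewrite big_map /= (eq_bigr (fun p => chiT R k m *: p.2)) => [|p /eqP -> //].
  rewrite -scaler_sumr => /(congr1 (fun s => chiT R k (- m) *: s)).
  rewrite scaler0 scalerA (_ : _ * _ = 1) ?scale1r //.
  by apply: coordRing_eq => t'; rewrite coordRingM !chiTE mulrC chiNK.
rewrite (big_regroup fst) big1 // => m _.
rewrite (eq_bigr (fun p => cstA (val o) (chi m t) *: p.2)) => [|p /eqP -> //].
by rewrite -scaler_sumr comp0 scaler0.
Qed.

Section Fiber.
Variables (x0 : torus k n) (E : vectType k) (ev : sec V o -> E).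
Hypothesis fiber_E : is_fiber x0 ev.

Lemma evD s s' : ev (s + s') = ev s + ev s'.
Proof. by case: fiber_E. Qed.

Lemma evZ f s : ev (f *: s) = f x0 *: ev s.
Proof. by case: fiber_E. Qed.

Lemma ev0 : ev 0 = 0.
Proof. by rewrite -(scale0r (0 : sec V o)) evZ scale0r. Qed.

Lemma evB s s' : ev (s - s') = ev s - ev s'.
Proof. by rewrite evD -scaleN1r evZ scaleN1r. Qed.

Lemma ev_sum (I : Type) (r : seq I) (P : pred I) (f : I -> sec V o) :
  ev (\sum_(i <- r | P i) f i) = \sum_(i <- r | P i) ev (f i).
Proof. exact: (big_morph _ evD ev0). Qed.

(** A section of weight [u] has constant values, and a section killed by
    [ev] is a combination of functions vanishing at [x0], hence takes
    the value 0 at [x0]. *)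
Lemma ev_weight_inj u s : weight_sec u s -> ev s = 0 -> s = 0.
Proof.
move=> us evs; have [_ _ _ /(_ s evs) [p [f [s' [f0 sE]]]]] := fiber_E.
have [psi psiP] := choice (fun i => orbit_values_exists u (s' i)).
have := orbit_values_sum (index_enum 'I_p)
  (fun i => orbit_values_scale (f i) (psiP i)).
rewrite -sE => /(orbit_values_unique (orbit_values_weight us)) /(_ x0) ->.
by rewrite big1 // => i _; rewrite f0 rmorph0 scale0r.
Qed.

(** The value of any section over [e], transported to weight [u]. *)
Lemma ev_weight_surj u e : exists2 s, weight_sec u s & ev s = e.
Proof.
have [_ _ /(_ e) [s <-] _] := fiber_E.
have [psi [l [lP -> psiE]]] := orbit_values_exists u s.
exists (\sum_(p <- l) cstA (val o) (chi p.1 x0) *: p.2).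
  by apply: weight_sec_sum => p /lP pw _; apply: weight_secZ.
by rewrite !ev_sum; apply: eq_bigr => p _; rewrite !evZ.
Qed.

End Fiber.

End Weights.

(** * Subspaces and arrangements *)

Section Subspaces.
Variables (k : fieldType) (E : vectType k).

(** A subspace of maximal dimension among those contained in [P]. *)
Lemma closed_vspace (P : E -> Prop) :
  P 0 -> (forall a x y, P x -> P y -> P (a *: x + y)) ->
  exists U : {vspace E}, forall e, e \in U <-> P e.
Proof.
move=> P0 PD.
pose Q d := `[< exists U : {vspace E}, \dim U = d /\ forall e, e \in U -> P e >].
have exQ : exists d, Q d.
  exists 0%N; apply/asboolP; exists 0%VS; rewrite dimv0; split=> // e.
  by rewrite memv0 => /eqP ->.
have Qb d : Q d -> (d <= \dim {:E})%N.
  by move=> /asboolP[U [<- _]]; apply/dimvS/subvf.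
case: (ex_maxnP exQ Qb) => d /asboolP[U [dU UP]] dmax; exists U => e.
split=> [/UP//|eP].
suff -> : U = (U + <[e]>)%VS by apply: (subvP (addvSr _ _)); rewrite memv_line.
apply/eqP; rewrite eqEdim addvSl dU; apply: dmax; apply/asboolP.
exists (U + <[e]>)%VS; split=> // _ /memv_addP[x xU [_ /vlineP[a ->] ->]].
by rewrite addrC; apply/PD/UP.
Qed.

Section DirectSum.
Variables (I : finType) (L : I -> {vspace E}).
Hypothesis L_direct : directv (\sum_j L j).

Lemma mem_partial_sum (c : I -> E) (P : pred I) : (forall j, c j \in L j) ->
  (\sum_j c j \in (\sum_(j | P j) L j)%VS) <-> (forall j, c j != 0 -> P j).
Proof.
move=> cL; split=> [/memv_sumP[d dL e] j cj|cP]; last first.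
  rewrite (bigID P) /= [X in _ + X]big1 ?addr0 => [|j].
    exact: memv_sumr.
  by apply: contraNeq => /cP.
pose d' i := if P i then d i else 0.
have d'L i : d' i \in L i by rewrite /d'; case: ifP => [/dL//|_]; rewrite mem0v.
have := directv_sum_unique L_direct c d' (fun i _ => cL i) (fun i _ => d'L i).
rewrite e big_mkcond eqxx => /esym/forallP/(_ j)/eqP cE.
by apply: contraNT cj => /negPf Pj; rewrite cE /d' Pj.
Qed.

End DirectSum.

(** Every member of the arrangement is a sum of irreducible ones, by induction
    on the dimension, and the ground set contains bases of these. *)
Lemma ground_set_spans (Arr : set {vspace E}) (BB : seq E) (W : {vspace E}) :
  matroid_ground_set Arr BB -> Arr W -> <<[seq e <- BB | e \in W]>>%VS = W.
Proof.
move=> [m [U [B [_ irrU Bbasis _ [_ BBE]]]]] ArrW.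
apply/eqP; rewrite eqEsubv; apply/andP; split.
  by apply/span_subvP => e; rewrite mem_filter => /andP[].
have [d] := ubnP (\dim W); elim: d W ArrW => // d IH W ArrW dW.
have [irrW|/not_andP[//|/contrapT[s [sP sE]]]] := pselect (irreducible_in Arr W).
  have [i Wi] := (irrU W).1 irrW; rewrite {1}Wi -(span_basis (Bbasis i)).
  apply: sub_span => e eB; rewrite mem_filter Wi (basis_mem (Bbasis i)) //.
  by apply/BBE; exists i.
rewrite {1}sE big_seq; apply: (big_ind (fun X => X <= _)%VS) => [|X Y XS YS|W' W's].
- exact: sub0v.
- by rewrite subv_add XS.
have [ArrW' neW'] := sP W' W's.
have W'W : (W' <= W)%VS by rewrite sE (big_rem W') //= addvSl.
apply: subv_trans (IH W' ArrW' _) _.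
  rewrite -ltnS; apply: leq_trans dW; rewrite ltnS ltn_neqAle dimvS // andbT.
  by apply/eqP => e; apply: neW'; apply/eqP; rewrite eqEdim W'W e leqnn.
apply: sub_span => e; rewrite !mem_filter => /andP[eW' ->].
by rewrite (subvP W'W).
Qed.

End Subspaces.

(** * Global sections and the valuation *)

Section GlobalSections.
Variables (R : realType) (k : fieldType) (n : nat).
Hypothesis k_char0 : [pchar k] =i pred0.
Variables (F : fan R n) (V : toricBundle k F) (x0 : torus k n).
Variables (E : vectType k) (ev : sec V (zero_cone F) -> E).
Hypothesis fiber_E : is_fiber x0 ev.
Local Notation o := (zero_cone F).
Implicit Types (sigma rho : cone_of F) (u w : 'rV[int]_n).

Lemma primitive_generator_mem rho w :
  primitive_generator (val rho) w -> val rho (latR R w).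
Proof. by move=> [_ ->]; exists 1; rewrite ?scale1r. Qed.

(** Multiplying by a character orthogonal to the ray changes the weight, so
    the filtration step may be computed with any weight of the right degree. *)
Lemma klyachkoP rho w u e : primitive_generator (val rho) w ->
  klyachko ev rho w (pairZ u w) e <->
  exists2 s : sec V rho, weight_sec u s & ev (res o s) = e.
Proof.
move=> [_ rhoE]; split=> [[u' [s [u'w us <-]]]|[s us <-]]; last by exists u, s.
have perp x : val rho x -> charR (u' - u) x = 0.
  rewrite rhoE => -[a _ ->]; rewrite /charR pairRZr -/(charR _ _).
  by rewrite charRD charRN !charR_latR u'w subrr mulr0.
pose mS := monomials_perp perp.
exists (cstA (val rho) (chi (u - u') x0) *: (chiA k mS *: s)).
  by apply: weight_secZ; have := weight_sec_chi mS us; rewrite opprB addrC subrK.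
rewrite !res_toT !(evZ fiber_E) scalerA !toTE /= -(opprB u' u) mulrC chiNK.
by rewrite scale1r.
Qed.

Lemma res_weight_sec sigma u (s : sec V sigma) :
  weight_sec u s -> weight_sec u (res o s).
Proof. by move=> us t; rewrite -(act_res (zero_cone_face _)) us res_cstA. Qed.

(** A vector of the fiber comes from a global section of weight [u] as soon as
    it comes from sections of weight [u] over the charts of the rays: all of
    these restrict to the same section over the open orbit, which
    then extends to every chart. *)
Lemma global_section_rays u e :
  (exists2 s, H0_weight V u s & ev (s o) = e) <->
  forall rho w, primitive_generator (val rho) w ->
    klyachko ev rho w (pairZ u w) e.
Proof.
split=> [[s [gs us] <-] rho w prim|ke].
  apply/klyachkoP => //; exists (s rho); first exact: us.
  by rewrite gs //; apply: zero_cone_face.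
have [s0 us0 evs0] := ev_weight_surj k_char0 fiber_E u e.
have ext sigma : exists s : sec V sigma, res o s = s0.
  have [p [rho [w [rhoP sw]]]] := cone_rays sigma.
  apply: (extend_from_rays k_char0 (fun i => (rhoP i).1) _ sw) => i.
    exact: primitive_generator_mem (rhoP i).2.
  have /klyachkoP [//|s us evs] := ke _ _ (rhoP i).2.
  exact: (rhoP i).2.
  exists s; apply/eqP; rewrite -subr_eq0; apply/eqP.
  apply: (ev_weight_inj k_char0 fiber_E (u := u)).
    by apply: weight_secB us0; apply: res_weight_sec.
  by rewrite (evB fiber_E) evs evs0 subrr.
pose s sigma := projT1 (cid (ext sigma)).
have sE sigma : res o (s sigma) = s0 by rewrite /s; case: cid.
exists s; last by rewrite -evs0 -(sE o) res_id.
split=> [sigma tau st|sigma t]; apply/eqP; rewrite -subr_eq0; apply/eqP.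
  apply: res_zero_inj; rewrite (res_zmod_morphism (zero_cone_face tau)).
  by rewrite (res_comp st (zero_cone_face tau)) !sE subrr.
apply: res_zero_inj; rewrite (res_zmod_morphism (zero_cone_face sigma)).
by rewrite (act_res (zero_cone_face _)) res_cstA sE us0 subrr.
Qed.

Hypothesis F_complete : complete F.
Variable v : E -> 'rV[R]_n -> \bar R.
Hypothesis valuation_v : is_valuation ev v.

Lemma klyachko_components sigma L uu (c : 'I_(\dim {:E}) -> E) rho w i :
  klyachko_decomposition ev sigma L uu -> (forall j, c j \in L j) ->
  face (val rho) (val sigma) -> primitive_generator (val rho) w ->
  klyachko ev rho w i (\sum_j c j) <->
  forall j, c j != 0 -> i <= pairZ (uu j) w.
Proof.
move=> [_ Ldir _ kly] cL face_rho prim.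
apply: iff_trans (kly rho w face_rho prim i _) _.
exact: mem_partial_sum.
Qed.

(** The inequality [u <= v e] may be tested on the primitive generators of the
    rays, because [v e] is on each cone a minimum of linear functions and the
    cone is generated by its rays. *)
Lemma valuation_rays u e :
  (forall x, ((charR u x)%:E <= v e x)%E) <->
  forall rho w, primitive_generator (val rho) w ->
    klyachko ev rho w (pairZ u w) e.
Proof.
have [_ v0 vE] := valuation_v; split=> [uv rho w prim|ke x].
  have [L [uu [dec vL]]] := vE rho; have [_ _ Lfull _] := dec.
  have /memv_sumP[c cL ec] : e \in (\sum_j L j)%VS by rewrite Lfull memvf.
  have {}cL j : c j \in L j by apply: cL.
  move: (uv (latR R w)); rewrite ec => uvw.
  apply/(klyachko_components _ dec cL (cone_face_refl rho) prim) => j cj.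
  have e0 : \sum_j c j != 0.
    apply: contra cj => /eqP ce; apply/eqP.
    have [_ Ldir _ _] := dec.
    exact: (directv_sum_independent Ldir c).
  move: uvw; rewrite vL //; last exact: primitive_generator_mem.
  move=> /bigmin_geP[_ /(_ j cj)].
  by rewrite lee_fin !charR_latR ler_int.
have [sigma sF sx] := F_complete x.
pose sg : cone_of F := exist (fun s => s \in cones F) _ (mem_set sF).
have [L [uu [dec vL]]] := vE sg; have [_ _ Lfull _] := dec.
have /memv_sumP[c cL ec] : e \in (\sum_j L j)%VS by rewrite Lfull memvf.
have {}cL j : c j \in L j by apply: cL.
have [->|e0] := eqVneq e 0; first by rewrite v0 leey.
rewrite ec vL -?ec //; apply/bigmin_geP; split=> [|j cj]; first exact: leey.
rewrite lee_fin; have [p [rho [w [rhoP sw]]]] := cone_rays sg.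
have [a [a0 ->]] := sw x sx; rewrite !charR_sum ler_sum // => i _.
rewrite ler_wpM2l // !charR_latR ler_int.
have := ke _ _ (rhoP i).2; rewrite ec.
move/(klyachko_components _ dec cL (rhoP i).1 (rhoP i).2); exact.
Qed.

Lemma H0_weight_comb u c s s' : H0_weight V u s -> H0_weight V u s' ->
  H0_weight V u (fun sigma => cstA (val sigma) c *: s sigma + s' sigma).
Proof.
move=> [gs us] [gs' us']; split=> [sigma tau st|sigma].
  rewrite resD // gs' // (resZ st (g := cstA (val tau) c)) //.
  by rewrite gs.
by apply: weight_secD => //; apply: weight_secZ.
Qed.

Lemma H0_weight_vspace u : exists U : {vspace E},
  forall e, e \in U <-> exists2 s, H0_weight V u s & ev (s o) = e.
Proof.
apply: closed_vspace => [|c _ _ [s sH <-] [s' sH' <-]].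
  exists (fun=> 0); last exact: ev0 fiber_E.
  split=> [sigma tau st|sigma]; first exact: res0.
  exact: weight_sec0.
exists (fun sigma => cstA (val sigma) c *: s sigma + s' sigma).
  exact: H0_weight_comb.
by rewrite (evD fiber_E) (evZ fiber_E).
Qed.

(** Sections of weight [u] are determined by their value at [x0]. *)
Lemma H0_weight_dim u (U : {vspace E}) :
  (forall e, e \in U <-> exists2 s, H0_weight V u s & ev (s o) = e) ->
  has_dim (H0_weight V u) (\dim U).
Proof.
move=> UP; have bP i : exists s, H0_weight V u s /\ ev (s o) = (vbasis U)`_i.
  have /UP[s sH sE] : (vbasis U)`_i \in U.
    have [iU|iU] := ltnP i (size (vbasis U)); last by rewrite nth_default ?mem0v.
    by apply: vbasis_mem; apply: mem_nth.
  by exists s.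
have [b bH] := choice bP.
have ev_comb (c : {ffun 'I_(\dim U) -> k}) :
    ev (\sum_i cstA (val o) (c i) *: b i o) = \sum_i c i *: (vbasis U)`_i.
  by rewrite (ev_sum fiber_E); apply: eq_bigr => i _; rewrite (evZ fiber_E) (bH i).2.
exists (fun i => b i); split=> [i|s sH]; first by have [] := bH i.
have evU : ev (s o) \in U by apply/UP; exists s.
exists [ffun i => coord (vbasis U) i (ev (s o))]; split=> [sigma|c cE].
  apply/eqP; rewrite -subr_eq0; apply/eqP; apply: res_zero_inj.
  rewrite (res_zmod_morphism (zero_cone_face sigma)).
  rewrite (res_sum (zero_cone_face sigma)) sH.1; last exact: zero_cone_face.
  under eq_bigr => i _.
    rewrite res_cstA (bH i).1.1; last exact: zero_cone_face.
    over.
  apply: (ev_weight_inj k_char0 fiber_E (u := u)).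
    apply: weight_secB; first exact: sH.2.
    apply: weight_sec_sum => i _ _; apply: weight_secZ; exact: (bH i).1.2.
  rewrite (evB fiber_E) ev_comb {1}(coord_vbasis evU).
  by apply/eqP; rewrite subr_eq0; apply/eqP/eq_bigr => i _; rewrite ffunE.
apply/ffunP => i; rewrite ffunE cE ev_comb coord_sum_free //.
exact/basis_free/vbasisP.
Qed.

End GlobalSections.

(** * Dimension of the weight spaces of global sections *)

Theorem mainTheorem3 (R : realType) (k : fieldType) (n : nat)
    (k_char0 : [pchar k] =i pred0)
    (Sigma : fan R n) (Sigma_complete : complete Sigma)
    (V : toricBundle k Sigma) (x0 : torus k n)
    (E : vectType k) (ev : sec V (zero_cone Sigma) -> E)
    (fiber_E : is_fiber x0 ev)
    (v : E -> 'rV[R]_n -> \bar R) (valuation_v : is_valuation ev v)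
    (S : set ('rV[R]_n -> \bar R)) (S_PL : S `<=` @PL R n)
    (S_char : forall u : 'rV[int]_n, S (fun x => (charR u x)%:E))
    (S_max : forall phi psi, S phi -> S psi ->
       S (fun x => Order.max (phi x) (psi x)))
    (BB : seq E) (BB_ground : matroid_ground_set (arrangement v S) BB)
    (u : 'rV[int]_n) :
  has_dim (H0_weight V u)
    (matroid_rank BB [set e | polytope (v e) (latR R u)]).
Proof.
have globalP e : (forall x, ((charR u x)%:E <= v e x)%E) <->
    exists2 s, H0_weight V u s & ev (s (zero_cone Sigma)) = e.
  apply: iff_trans (valuation_rays Sigma_complete valuation_v u e) _.
  exact: iff_sym (global_section_rays k_char0 fiber_E u e).
have [U UP] := H0_weight_vspace fiber_E u.
have Uge e : e \in U <-> forall x, ((charR u x)%:E <= v e x)%E.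
  exact: iff_trans (UP e) (iff_sym (globalP e)).
have UArr : arrangement v S U by exists (fun x => (charR u x)%:E).
rewrite /matroid_rank (eq_filter (a2 := fun e => e \in U)) => [|e].
  rewrite (ground_set_spans BB_ground UArr).
  exact: (H0_weight_dim k_char0 fiber_E UP).
by apply/asboolP/idP => [/Uge|/Uge].
Qed.
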